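(* Let $p\in(0,1)$ be fixed, and for each $n\ge 1$ let $\omega\in\{0,1,2\}^n$ be sampled according to the Bernoulli initial condition of parameter $p$ with a second class particle in uniform position. Let $E_n=E_n(\omega)=T_n(\omega)-T_n^{(2)}(\Pi_1\omega)$ be the excess. Then, as $n\to\infty$, $E_n$ converges in distribution: $$E_n\Longrightarrow\begin{cases}1&\text{if }p>1/2,\\ X&\text{if }p=1/2,\\ 0&\text{if }p<1/2,\end{cases}$$ where the distribution of $X$ is given by $\mathbf P(X=0)=\mathbf P(X=1)=1/2$.
   Context: Two types: $\Omega_n^{(2)}=\{0,2\}^n$. The map $Z^{(2)}:\Omega_n^{(2)}\to\Omega_n^{(2)}$ simultaneously replaces every occurrence of two consecutive letters $02$ by $20$ (such occurrences never overlap). $T_n^{(2)}(\eta)=\min\{k\ge0:(Z^{(2)})^k(\eta)=(Z^{(2)})^{k+1}(\eta)\}$. Three types: $\Omega_n=\{0,1,2\}^n$. The map $Z:\Omega_n\to\Omega_n$ simultaneously swaps neighbouring pairs in increasing order ($01\to10$, $02\to20$, $12\to21$), where in a substring $012$ the pair $12$ has priority, i.e. $012\to021$. Formally: if $\omega_i=0,\omega_{i+1}=1,\omega_{i+2}=2$ for some $1\le i\le n-2$, then $(Z\omega)_i=0,(Z\omega)_{i+1}=2,(Z\omega)_{i+2}=1$; if $\omega_{i-1}\ge\omega_i<\omega_{i+1}\ge\omega_{i+2}$ for some $1\le i\le n-1$ (inequalities involving the nonexistent $\omega_0$ or $\omega_{n+1}$ are considered satisfied), then $(Z\omega)_i=\omega_{i+1}$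 and $(Z\omega)_{i+1}=\omega_i$; all other entries are unchanged. $T_n(\omega)=\min\{k\ge0:Z^k(\omega)=Z^{k+1}(\omega)\}$. Projection: $\Pi_1:\Omega_n\to\Omega_n^{(2)}$ acts letterwise by $0\mapsto0$, $1\mapsto0$, $2\mapsto2$. Bernoulli initial condition of parameter $p$ with a second class particle in uniform position: first sample $\omega'\in\{0,2\}^n$ with independent letters, each equal to $2$ with probability $p$ and to $0$ with probability $1-p$. Let $A(\omega')$ be the set of positions of $0$s in $\omega'$. Given $\omega'$, choose $U$ uniformly from $A(\omega')$ and change the letter at position $U$ into $1$ to obtain $\omega$. If $A(\omega')=\emptyset$, set $\omega_1=1$ (so $U=1$), keeping the other letters. *)

(* Defs.v *)
From HB Require Import structures.
From mathcomp Require Import all_boot all_order all_algebra.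
From mathcomp Require Import all_classical all_reals all_analysis.

Set Implicit Arguments.
Unset Strict Implicit.
Unset Printing Implicit Defensive.

Import Order.TTheory GRing.Theory Num.Theory.
Import numFieldNormedType.Exports.

Local Open Scope classical_set_scope.
Local Open Scope ring_scope.

(* Positions are numbered from 0: the letter omega_i of the text is the letter
   of index i - 1 here.  A letter of {0, 2} is a boolean, [true] standing for 2
   and [false] for 0; [bernoulli_prob p] gives [true] the mass p. *)

Section two_types.
Variable n : nat.
Implicit Types (e : n.-tuple bool) (i k : nat).

Definition letter2 e i : bool := nth false e i.

Definition pat02 e i : bool :=
  [&& (i.+1 < n)%N, ~~ letter2 e i & letter2 e i.+1].

Definition Z2 e : n.-tuple bool :=
  [tuple if pat02 e i then true
         else if (0 < i)%N && pat02 e i.-1 then false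
         else letter2 e i | i < n].

End two_types.

Section three_types.
Variable n : nat.
Implicit Types (w : n.-tuple 'I_3) (i k : nat).

Definition letter w i : 'I_3 := nth ord0 w i.

Definition pat012 w i : bool :=
  [&& (i.+2 < n)%N, letter w i == 0, letter w i.+1 == 1 & letter w i.+2 == 2].

Definition swappable w i : bool :=
  [&& (i.+1 < n)%N,
      (i == 0%N) || (letter w i <= letter w i.-1)%N,
      (letter w i < letter w i.+1)%N
    & (i.+2 == n) || (letter w i.+2 <= letter w i.+1)%N].

Definition Z w : n.-tuple 'I_3 :=
  [tuple if pat012 w i then 0
         else if (0 < i)%N && pat012 w i.-1 then 2
         else if (1 < i)%N && pat012 w i.-2 then 1
         else if swappable w i then letter w i.+1
         else if (0 < i)%N && swappable w i.-1 then letter w i.-1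
         else letter w i | i < n].

End three_types.

Lemma lex_iter_stab d (A : finOrderType d) n
    (f : n.-tuple A -> n.-tuple A) :
  (forall w (i : 'I_n), (forall j : 'I_n, (j < i)%N ->
     tnth (f w) j = tnth w j) -> tnth (f w) i != tnth w i ->
     (tnth w i < tnth (f w) i)%O) ->
  forall w, exists k, iter k f w == iter k.+1 f w.
Proof.
move=> fP.
pose lt (v w : n.-tuple A) := @Order.lt _ (n.-tuplelexi A) v w.
pose m w := #|[pred v : n.-tuple A | lt v w]|.
have lt_f w : f w != w -> lt w (f w).
  move=> fw.
  have /existsP[i0 Pi0] : [exists i, tnth (f w) i != tnth w i].
    apply/contraNT: fw => /existsPn H; apply/eqP/eq_from_tnth => i.
    by apply/eqP; have := H i; rewrite negbK.
  case: (@arg_minnP _ i0 (fun i => tnth (f w) i != tnth w i) val Pi0) => i Pi mi.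
  have eqi (j : 'I_n) : (j < i)%N -> tnth (f w) j = tnth w j.
    by move=> ji; apply/eqP/negPn/negP => /mi; rewrite leqNgt ji.
  apply/Order.TupleLexiOrder.Exports.ltxi_tuplePlt; exists i; last exact: fP.
  by move=> j /eqi ->.
have lt_m w : f w != w -> (m w < m (f w))%N.
  move=> /lt_f wfw; apply/proper_card/properP; split.
    by apply/fintype.subsetP => v; rewrite !inE /lt => /lt_trans; apply.
  by exists w; rewrite !inE /lt ?ltxx.
move=> w.
have [k] := ubnP (#|{: n.-tuple A}| - m w)%N.
elim: k w => // k IH w; rewrite ltnS => wk.
have [fw|fw] := eqVneq (f w) w; first by exists 0%N; rewrite /= fw.
have [|j fj] := IH (f w).
  have mw := lt_m _ fw; apply: leq_trans wk; apply: ltn_sub2l => //.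
  by apply: leq_trans mw _; exact: max_card.
by exists j.+1; rewrite iterSr (iterSr j.+1).
Qed.

Section stabilization.
Variable n : nat.

Lemma Z2_stab (e : n.-tuple bool) :
  exists k, iter k (@Z2 n) e == iter k.+1 (@Z2 n) e.
Proof.
apply: (@lex_iter_stab _ bool) => {}e i; rewrite !tnth_mktuple.
rewrite (tnth_nth false) -/(letter2 e i) => eqi.
case: ifP => [/and3P[_ ei _] _|_]; first by move: ei; case: letter2.
case: ifP => [/andP[i0 p]|]; last by rewrite eqxx.
have i1n : (i.-1 < n)%N by rewrite (leq_ltn_trans (leq_pred _)).
have := eqi (Ordinal i1n); rewrite tnth_mktuple (tnth_nth false) /= p prednK // leqnn.
rewrite -/(letter2 e i.-1) => /(_ isT) e1.
by move: p => /and3P[_]; rewrite -e1.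
Qed.

Lemma Z_stab (w : n.-tuple 'I_3) :
  exists k, iter k (@Z n) w == iter k.+1 (@Z n) w.
Proof.
apply: (@lex_iter_stab _ 'I_3) => {}w i; rewrite !tnth_mktuple.
rewrite (tnth_nth ord0) -/(letter w i) => eqi.
have prev (j : nat) (ji : (j < i)%N) :=
  eqi (Ordinal (ltn_trans ji (ltn_ord i))) ji.
case: ifP => [/and4P[_ /eqP-> _ _]|_]; first by rewrite eqxx.
case: ifP => [/andP[i0 p] _|_].
  by move: p => /and4P[_ _]; rewrite prednK // => /eqP->.
case: ifP => [/andP[i1 p]|_].
  have i2i : (i.-2.+1 < i)%N by case: (nat_of_ord i) i1 => [|[]].
  have := prev _ i2i; rewrite tnth_mktuple (tnth_nth ord0) /= p -/(letter w _).
  move: p => /and4P[_ _ /eqP p1 _]; rewrite p1.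
  case: ifP => [/and4P[_ + _ _]|_ /= /eqP //]; rewrite p1.
  by [].
case: ifP => [/and4P[_ _ + _] _|_] //.
case: ifP => [/andP[i0 p]|_]; last by rewrite eqxx.
have i1i : (i.-1 < i)%N by case: (nat_of_ord i) i0.
have := prev _ i1i; rewrite tnth_mktuple (tnth_nth ord0) /= -/(letter w _) p.
move: (p) => /and4P[_ p1 p2 p3]; rewrite prednK // in p2 p3.
case: ifP => [/and4P[q0 /eqP q1 /eqP q2 /eqP q3]|_].
  rewrite prednK // in q0 q2 q3.
  by move: p3; rewrite q2 q3 => /orP[/eqP p3|//]; rewrite p3 ltnn in q0.
case: ifP => [/andP[j0 /and4P[_ _ /eqP q2 /eqP q3]]|_].
  rewrite prednK // in q2 q3; rewrite prednK // in q3.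
  by move: p2; rewrite q2 q3.
case: ifP => [/andP[j0 /and4P[_ _ _ /eqP q3]]|_].
  have e : i.-1.-2.+2 = i.-1 by case: (nat_of_ord i) j0 => [|[|[]]].
  by rewrite e in q3; move: p2; rewrite q3 ltnNge -ltnS ltn_ord.
by move=> e; move: p2; rewrite prednK // in e; rewrite e ltnn.
Qed.

End stabilization.

Section stopping_times.
Variable n : nat.

Definition T2 (e : n.-tuple bool) : nat := ex_minn (Z2_stab e).

Definition T (w : n.-tuple 'I_3) : nat := ex_minn (Z_stab w).

Definition Pi1 (w : n.-tuple 'I_3) : n.-tuple bool :=
  [tuple tnth w i == 2 | i < n].

Definition excess (w : n.-tuple 'I_3) : int := (T w)%:Z - (T2 (Pi1 w))%:Z.

End stopping_times.

Section initial_condition.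
Variables (R : realType) (p : R) (n : nat).
Implicit Types (e : n.+1.-tuple bool) (u : 'I_n.+1) (w : n.+1.-tuple 'I_3).

Definition bernoulli_word e : R :=
  \prod_(i < n.+1) fine (bernoulli_prob p [set tnth e i]%classic).

Definition zeros e : {set 'I_n.+1} := [set i | ~~ tnth e i]%SET.

(* conditional probability that U = u given that the two-type word is e *)
Definition position_pmf e u : R :=
  if zeros e == finset.set0 then (u == ord0)%:R
  else (u \in zeros e)%:R / #|zeros e|%:R.

Definition put_second e u : n.+1.-tuple 'I_3 :=
  [tuple if i == u then 1 else if tnth e i then 2 else 0 | i < n.+1].

Definition initial_pmf w : R :=
  \sum_(eu : n.+1.-tuple bool * 'I_n.+1 | put_second eu.1 eu.2 == w)
    bernoulli_word eu.1 * position_pmf eu.1 eu.2.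

Lemma initial_pmf_ge0 w : 0 <= initial_pmf w.
Proof.
apply: sumr_ge0 => -[e u] _ /=; apply: mulr_ge0.
  by apply: prodr_ge0 => i _; exact: fine_ge0.
by rewrite /position_pmf; case: ifP => // _; rewrite divr_ge0.
Qed.

Lemma sum_position_pmf e : \sum_u position_pmf e u = 1.
Proof.
rewrite /position_pmf; case: (boolP (zeros e == finset.set0)) => [_|e0].
  by rewrite (bigD1 ord0) //= big1 ?addr0 // => u /negbTE->.
rewrite -mulr_suml -natr_sum.
have -> : (\sum_u (u \in zeros e) = #|zeros e|)%N.
  rewrite -sum1_card [RHS]big_mkcond; apply: eq_bigr => u _.
  by case: (u \in zeros e).
by rewrite divff // pnatr_eq0 cards_eq0.
Qed.

Lemma sum_bernoulli_word : \sum_e bernoulli_word e = 1.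
Proof.
pose q (b : bool) : R := fine (bernoulli_prob p [set b]%classic).
have q1 : \sum_b q b = 1.
  rewrite big_bool /= /q -fineD ?fin_num_measure // -measureU //.
    rewrite -setT_bool; apply: congr1 (_ : _ = 1%E).
    exact: (probability_setT (bernoulli_prob p : probability bool R)).
  by rewrite disjoints_subset => -[].
rewrite (reindex (@tuple_of_finfun _ n.+1)) /=; last first.
  by exists (@finfun_of_tuple _ n.+1) => ? _;
     [exact: tuple_of_finfunK|exact: finfun_of_tupleK].
transitivity (\prod_(i < n.+1) \sum_b q b); last by rewrite big1.
rewrite bigA_distr_bigA /=; apply: eq_bigr => f _; apply: eq_bigr => i _.
by rewrite tnth_mktuple.
Qed.

Lemma sum_initial_pmf : \sum_w initial_pmf w = 1.
Proof.
transitivity (\sum_(eu : n.+1.-tuple bool * 'I_n.+1)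
    bernoulli_word eu.1 * position_pmf eu.1 eu.2).
  by rewrite [RHS](partition_big (fun eu => put_second eu.1 eu.2) xpredT).
rewrite -(pair_bigA _ (fun e u => bernoulli_word e * position_pmf e u)) /=.
rewrite -[RHS]sum_bernoulli_word; apply: eq_bigr => e _.
by rewrite -mulr_sumr sum_position_pmf mulr1.
Qed.

End initial_condition.

(* An alias of the type of words, so that it can carry the discrete
   sigma-algebra. *)
Definition Omega (n : nat) : Type := n.-tuple 'I_3.

HB.instance Definition _ n := Finite.on (Omega n).
HB.instance Definition _ n :=
  isPointed.Build (Omega n) [tuple ord0 | _ < n].
HB.instance Definition _ n := @isMeasurable.Build default_measure_display
  (Omega n) discrete_measurable discrete_measurable0
  discrete_measurableC discrete_measurableU.

Definition initial_law (R : realType) (p : R) (n : nat) :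
    set (Omega n.+1) -> \bar R :=
  fun A => (\sum_(w \in A) (initial_pmf p w)%:E)%E.
Arguments initial_law {R} p n _.

Section initial_law_probability.
Variables (R : realType) (p : R) (n : nat).
Local Notation law := (@initial_law R p n).

Let law0 : law set0 = 0%E.
Proof. by rewrite /initial_law fsbig_set0. Qed.

Let law_ge0 A : (0 <= law A)%E.
Proof.
rewrite /initial_law fsbig_finite//= sumEFin lee_fin.
by apply: sumr_ge0 => w _; exact: initial_pmf_ge0.
Qed.

Let law_sigma_additive : semi_sigma_additive law.
Proof.
move=> F mF tF mUF; rewrite /initial_law; apply: cvg_toP.
  apply: ereal_nondecreasing_is_cvgn => i j ij.
  by apply: lee_sum_nneg_natr => // k _ _; exact: law_ge0.
transitivity (\sum_(0 <= i <oo) (\esum_(w in F i) (initial_pmf p w)%:E))%E.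
  apply: eq_eseriesr => k _; rewrite esum_fset//= => w _.
  by rewrite lee_fin initial_pmf_ge0.
rewrite -nneseries_sum_bigcup//=; last first.
  by move=> w; rewrite lee_fin initial_pmf_ge0.
by rewrite esum_fset//= => w _; rewrite lee_fin initial_pmf_ge0.
Qed.

HB.instance Definition _ := isMeasure.Build _ _ _ law
  law0 law_ge0 law_sigma_additive.

Let law_setT : law [set: _] = 1%E.
Proof.
rewrite /initial_law -[RHS]/(1%:E) -(sum_initial_pmf p n) -sumEFin.
rewrite fsbig_finite //=; apply: perm_big.
rewrite uniq_perm ?finmap.fset_uniq ?index_enum_uniq // => w.
by rewrite mem_index_enum in_fset_set ?mem_setT //; exact: finite_finset.
Qed.

HB.instance Definition _ :=
  @Measure_isProbability.Build _ _ R law law_setT.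

End initial_law_probability.

Definition excess_RV (R : realType) (n : nat) (w : Omega n) : R :=
  (excess w)%:~R.

HB.instance Definition _ (R : realType) (n : nat) :=
  @isMeasurableFun.Build _ _ (Omega n) R (@excess_RV R n)
    (fun _ _ _ => I).

Definition cvg_in_distribution (R : realType)
    (d_ : nat -> measure_display) (S_ : forall n, measurableType (d_ n))
    (P_ : forall n, probability (S_ n) R) (X_ : forall n, {RV (P_ n) >-> R})
    (d : measure_display) (S : measurableType d)
    (P : probability S R) (X : {RV P >-> R}) : Prop :=
  forall x : R, {for x, continuous (cdf X)} ->
    (cdf (X_ n) x @[n --> \oo] --> cdf X x)%classic.

(* Main.v *)
(** Read a word as a lattice path: a letter 2 is a down-step, a letter 0 or 1 an
    up-step.  One step of [Z2] turns every peak of the path into a valley, and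
    [Pi1] intertwines [Z] with [Z2], so the excess is the extra time the single
    letter 1 needs once the 2s are sorted.

    Let the 1 start at position u, with some 2 after it.
    - If a weak maximum of the path over [k, n], preceded by a letter 0, occurs at
      some k <= u, this configuration follows the dynamics until the last 2 has
      passed the 1 and still moves afterwards; the 1 trails it and finishes
      exactly one step later: the excess is 1.
    - If a weak running maximum at some position j >= u is followed by two
      up-steps and later by a 2, this double record moves left with the 1 in front
      of it until the 1 is ahead of all 0s: the excess is 0.

    So the excess is decided by whether the maximum of the path is attained before
    or after u.  Given that the letter at u is 0, the path before u and the path
    after u are independent.  For p <> 1/2 the drift decides.  For p = 1/2,
    exchanging the two sides shows that either event has probability about 1/2;
    ties, and the gap between a maximum and a double record, are negligible
    because a simple random walk of length n stays positive with probability
    tending to 0. *)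

Require Import Defs.
From HB Require Import structures.
From mathcomp Require Import all_boot all_order all_algebra.
From mathcomp Require Import all_classical all_reals all_analysis.
From mathcomp Require Import zify lra ring.

Set Implicit Arguments.
Unset Strict Implicit.
Unset Printing Implicit Defensive.

Import Order.TTheory GRing.Theory Num.Theory.
Import numFieldNormedType.Exports.

Local Open Scope classical_set_scope.
Local Open Scope ring_scope.

(** * Dynamics of the height path *)

Section height_dynamics.
Implicit Types (e : nat -> bool) (u i j k l m : nat).

Fixpoint height e k : int :=
  if k is k'.+1 then height e k' + (if e k' then -1 else 1) else 0.

Definition peak e k : bool := [&& (0 < k)%N, ~~ e k.-1 & e k].

(* [e i] says that letter i is a 2.  [flip] is one step of the two-type dynamics;
   [move e u] is the new position of the letter 1 sitting at [u], which is a 0 of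
   [e]. *)
Definition flip e i : bool :=
  if ~~ e i && e i.+1 then true
  else if peak e i then false else e i.

Definition move e u : nat :=
  if e u.+1 then u.+1 else if (0 < u)%N && ~~ e u.-1 then u.-1 else u.

(** A swap of 02 exchanges an up-step with a down-step, and the only prefix it affects is the one
    ending between the two letters. *)
Lemma height_flip e k : height (flip e) k = height e k - (peak e k)%:Z *+ 2.
Proof.
elim: k => [|k IH]; first by rewrite /peak.
rewrite /= IH; move: {IH}(height e k) => h; rewrite /flip /peak.
case: k => [|k] /=; first by case: (e 0%N); case: (e 1%N) => /=; lia.
by case: (e k); case: (e k.+1); case: (e k.+2) => /=; lia.
Qed.

Lemma heightS e k : height e k.+1 = height e k + (if e k then -1 else 1).
Proof. by []. Qed.

Lemma height_pred e k : (0 < k)%N ->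
  height e k = height e k.-1 + (if e k.-1 then -1 else 1).
Proof. by case: k. Qed.

Lemma flip_zero e i : ~~ flip e i -> ~~ e i \/ (0 < i)%N /\ ~~ e i.-1.
Proof.
rewrite /flip /peak; case: (e i) => /=; last by left.
by rewrite andbT; case: ifP => // /andP[i0 e1] _; right.
Qed.

Lemma flip_two e i : flip e i -> e i \/ e i.+1.
Proof.
rewrite /flip; case: (e i) => /=; first by left.
by case: (e i.+1) => /=; [right | case: ifP].
Qed.

Lemma flip_move e u : ~~ e u -> ~~ flip e (move e u).
Proof.
move=> eu; rewrite /move; case: ifP => e1.
  by rewrite /flip /peak /= e1 eu.
case: ifP => [/andP[u0 e2]|_]; rewrite /flip /peak.
  by rewrite prednK // (negbTE e2) (negbTE eu) /= !andbF.
by rewrite e1 (negbTE eu) /= !andbF.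
Qed.

Lemma flip_no_peak e : (forall k, ~~ peak e k) -> forall i, flip e i = e i.
Proof.
move=> np i; rewrite /flip (negbTE (np i)).
by have := np i.+1; rewrite /peak /= => /negbTE->.
Qed.

Definition front e u := forall i, (i < u)%N -> e i.

(* The condition on [j] is only imposed when some 0 precedes [j]: a prefix made of
   2s is frozen and does not sink with the maximum. *)
Definition double_record e u m :=
  [/\ (u <= m)%N, ~~ e m, ~~ e m.+1, e m.+2
    & forall j, (j <= m)%N -> (exists2 i, (i < j)%N & ~~ e i) ->
      height e j <= height e m].

(** With only 2s in front of it, the 1 acts as the leading 0: it moves only by letting a 2 pass, and
    that 2 joins the front. *)
Lemma front_step e u : ~~ e u -> front e u -> front (flip e) (move e u).
Proof.
move=> eu fr.
have fl i : (i < u)%N -> flip e i.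
  move=> iu; rewrite /flip fr //= /peak; case: i iu => //= i iu.
  by rewrite fr // ltnW.
rewrite /move; case: ifP => e1.
  move=> i; rewrite ltnS leq_eqVlt => /orP[/eqP->|/fl //].
  by rewrite /flip eu e1.
by case: u eu fr fl e1 => //= u _ fr fl _; rewrite fr.
Qed.

(** The letter before a record is a 0, since a 2 would make the previous height larger. The 2 ending
    the pattern 002 therefore advances into it and the pattern moves one place left, while the
    maximum drops by one. *)
Lemma double_record_step e u m : ~~ e u -> double_record e u m ->
  front (flip e) (move e u) \/ exists m', double_record (flip e) (move e u) m'.
Proof.
move=> eu [um em em1 em2 hm].
have [/forallP fr|/forallPn[/= [z zm] /= ez]] :=
    boolP [forall i : 'I_m, e i].
  left; apply: front_step => // i iu.
  by have im : (i < m)%N by [exact: leq_trans um]; have := fr (Ordinal im).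
case: m um em em1 em2 hm zm => // m um em em1 em2 hm zm.
have em0 : ~~ e m.
  apply/negP => em0; have zm' : (z < m)%N.
    by rewrite ltn_neqAle -ltnS zm andbT; apply: contraNneq ez => ->.
  by have := hm m (leqnSn m) (ex_intro2 _ _ z zm' ez); rewrite heightS em0; lia.
right; exists m; split.
- rewrite /move; case: (ltngtP u m) => [um'|mu|->].
  + by do 2?case: ifP => _; lia.
  + have -> : u = m.+1 by lia.
    by rewrite (negbTE em1) /= em0.
  + by rewrite (negbTE em); case: ifP; lia.
- by rewrite /flip (negbTE em0) (negbTE em) /= /peak (negbTE em0) !andbF.
- by rewrite /flip (negbTE em) (negbTE em1) /= /peak (negbTE em) !andbF.
- by rewrite /flip em1 em2.
move=> j jm [i ij fi].
have {i ij fi} [i ij ei] : exists2 i, (i < j)%N & ~~ e i.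
  by case/flip_zero: fi => [|[i0]] ei; [exists i|exists i.-1] => //; lia.
rewrite !height_flip [peak e m]/peak (negbTE em0) !andbF subr0.
have hj := hm j (leqW jm) (ex_intro2 _ _ i ij ei).
rewrite heightS (negbTE em0) in hj.
have [pj|] := boolP (peak e j).
    by move: hj; rewrite mulr2n; clear; lia.
(* A position at the old record height that is not a peak has a higher neighbour: on its left if it
   is preceded by a 2, on its right if it is followed by a 0. *)
suff: ~~ peak e j -> height e j <= height e m by lia.
have [//|lt] := leP (height e j) (height e m).
rewrite /peak (leq_ltn_trans _ ij) //= => pj; exfalso.
case ej1 : (e j.-1).
  have ij' : (i < j.-1)%N.
    have : i != j.-1 by apply: contraNneq ei => ->.
    by lia.
  have := hm j.-1; rewrite (height_pred e (ltac:(lia) : (0 < j)%N)) ej1 in lt.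
  rewrite heightS (negbTE em0) => H.
  have : height e j.-1 <= height e m + 1.
    by apply: H; [lia|exists i].
  by lia.
rewrite ej1 /= in pj.
have : height e j.+1 <= height e m.+1.
  by apply: hm; [rewrite ltnS|exists i => //; rewrite ltnW].
by rewrite !heightS (negbTE em0) (negbTE pj); lia.
Qed.

(** A peak at [k.+1] that dominates everything to its right. Heights beyond the last 2 are exempt:
    the final run of 0s does not sink with the maximum. *)
Definition back_record e u k :=
  [/\ (k.+1 < u)%N, ~~ e k, e k.+1
    & forall j, (k < j)%N -> (exists2 i, (j <= i)%N & e i) ->
      height e j <= height e k.+1].

(* The 1 has been passed by the last 2, at position [l], and stays at distance 1 or
   2 behind it; the distance is 2 after any move of that 2. *)
Definition trailing e u :=
  exists l, [/\ e l, forall i, (l < i)%N -> ~~ e i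
    & u = l.+2 \/ u = l.+1 /\ exists2 i, (i < l)%N & ~~ e i].

(** The 1 lands just behind the old position of the last 2. The new distance is 1 if that 2 was
    blocked by another 2, and 2 if it advanced. *)
Lemma trailing_step e u : ~~ e u -> (exists k, peak e k) ->
  trailing e u -> trailing (flip e) (move e u).
Proof.
move=> eu [k pk] [l [el lP ul]].
case: l el lP ul => [|l] el lP ul.
  move: pk => /and3P[k0 _ ek].
  by rewrite (negbTE (lP _ k0)) in ek.
have e2 := negbTE (lP l.+2 (ltnSn _)).
have e3 := negbTE (lP l.+3 ltac:(lia)).
have e4 := negbTE (lP l.+4 ltac:(lia)).
have mv : move e u = l.+2.
  by case: ul => [->|[-> _]]; rewrite /move /= ?e4 ?e3 ?e2 ?el.
have out i : (l.+1 < i)%N -> ~~ flip e i.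
  move=> li; rewrite /flip (negbTE (lP _ li)) (negbTE (lP i.+1 _)) /=; last by lia.
  by case: ifP.
have [e0|e0] := boolP (e l).
  exists l.+1; split=> //; first by rewrite /flip el /peak /= e0.
  right; split=> //; case/and3P: (pk) => k0 ek1 ek.
  have kl : (k <= l.+1)%N by rewrite leqNgt; apply: contraL ek => /lP.
  (* The step turns the peak at [k] into a valley, so it leaves a 0 there, ahead of the blocked last
     2. *)
  exists k; last by rewrite /flip ek pk.
  by rewrite ltn_neqAle kl andbT; apply: contraNneq ek1 => ->.
exists l; split; first by rewrite /flip e0 el.
  move=> i; rewrite leq_eqVlt => /orP[/eqP<-|/out //].
  by rewrite /flip el /= /peak /= e0 el.
by left.
Qed.

(** The 0 of the dominating peak moves right, so the pattern 02 shifts to [k.+1] with its maximum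
    one lower. This continues until the last 2 exchanges with the 1. *)
Lemma back_record_step e u k : ~~ e u -> back_record e u k ->
  (exists2 i, (u < i)%N & e i) ->
  (exists k', back_record (flip e) (move e u) k' /\
     exists2 i, (move e u < i)%N & flip e i)
  \/ trailing (flip e) (move e u).
Proof.
move=> eu [ku ek ek1 hk] [i ui ei].
(* Two 0s after the peak would bring the path back to its level, and the next position, being no 2,
   above it. *)
have up3 : e k.+2 || e k.+3.
  apply/norP => -[ek2 ek3].
  have ik : (k.+4 <= i)%N.
    have : i != k.+3 by apply: contraNneq ek3 => <-.
    by lia.
  have : height e k.+4 <= height e k.+1 by apply: hk; [lia|exists i].
  by rewrite 3!heightS ek1 (negbTE ek2) (negbTE ek3); lia.
have fk1 : ~~ flip e k.+1 by rewrite /flip ek1 /peak /= ek ek1.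
have fk2 : flip e k.+2.
  rewrite /flip /peak /= ek1 /=.
  by case: (e k.+2) up3 => //= ->.
have mu := flip_move eu.
have kmu : (k.+2 < move e u)%N.
  have ne : move e u != k.+2 by apply: contraNneq mu => ->.
  have ge : (u.-1 <= move e u)%N by rewrite /move; do 2?case: ifP => _; lia.
  suff : move e u <> k.+1 by move: ge ku ne; lia.
  move=> E; have uE : u = k.+2 by move: ge ku E; lia.
  by move: E; rewrite uE /move /= ek1; case: ifP => _; lia.
have bk : back_record (flip e) (move e u) k.+1.
  split=> // j kj [i' ji' fi'].
  clear up3 fk1 fk2 mu kmu i ui ei.
  have {i' ji' fi'} [i' ji' ei'] : exists2 i, (j <= i)%N & e i.
    by case/flip_two: fi' => ?; [exists i'|exists i'.+1] => //; lia.
  have np : peak e k.+2 = false by rewrite /peak /= ek1.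
  rewrite !height_flip np subr0 [height e k.+2]heightS ek1.
  have hj := hk j (ltnW kj) (ex_intro2 _ _ i' ji' ei').
  have [pj|] := boolP (peak e j).
    by move: hj; rewrite mulr2n; clear; lia.
  suff: ~~ peak e j -> height e j <= height e k.+1 - 1 by lia.
  have [//|lt] := leP (height e j) (height e k.+1 - 1).
  have j0 : (0 < j)%N by lia.
  rewrite /peak j0 /= => pj; exfalso.
  case ej1 : (e j.-1).
    have : height e j.-1 <= height e k.+1.
      by apply: hk; [lia|exists i' => //; lia].
    by rewrite (height_pred e j0) ej1 in lt; lia.
  rewrite ej1 /= in pj.
  have : height e j.+1 <= height e k.+1.
    apply: hk; [lia|exists i' => //].
    have : i' != j by apply: contraNneq pj => <-.
    by lia.
  by rewrite heightS (negbTE pj); lia.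
have [e1|e1] := boolP (e u.+1); last first.
  left; exists k.+1; split=> //.
  have mvu : (move e u <= u)%N.
    by rewrite /move (negbTE e1); case: ifP => // _; exact: leq_pred.
  have iu : (u.+1 < i)%N.
    by rewrite ltn_neqAle ui andbT; apply: contraNneq e1 => ->.
  have [fi|fi] := boolP (flip e i).
    by exists i => //; exact: leq_ltn_trans ui.
  exists i.-1; first by apply: leq_ltn_trans mvu _; clear -iu; lia.
  have [|[i0 ei1]] := flip_zero fi; first by rewrite ei.
  by rewrite /flip ei1 prednK // ei.
have mvE : move e u = u.+1 by rewrite /move e1.
have [[i' ui' ei']|nex] := EM (exists2 i, (u.+1 < i)%N & e i).
  left; exists k.+1; split=> //; rewrite mvE.
  have [fi|fi] := boolP (flip e i'); first by exists i'.
  have [|[i0 ei1]] := flip_zero fi; first by rewrite ei'.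
  exists i'.-1; last by rewrite /flip ei1 prednK // ei'.
  have : i'.-1 != u.+1 by apply: contraNneq ei1 => ->.
  by clear -ui'; lia.
have ne j : (u.+1 < j)%N -> ~~ e j.
  by move=> uj; apply/negP => ej; apply: nex; exists j.
(* The last 2 has just exchanged with the 1, so they are adjacent; the 0 now at [k.+1] shows that
   this 2 still has to move. *)
right; exists u; split.
- by rewrite /flip eu e1.
- move=> j; rewrite leq_eqVlt => /orP[/eqP<-|uj].
    by rewrite /flip /peak /= e1 eu.
  rewrite /flip (negbTE (ne _ uj)) (negbTE (ne j.+1 _)) /=; last exact: ltnW.
  by case: ifP.
by right; split=> //; exists k.+1 => //; exact: ltnW.
Qed.

End height_dynamics.

Lemma height_zeros e j d : (forall i, (j <= i < j + d)%N -> ~~ e i) ->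
  height e (j + d)%N = height e j + d%:Z.
Proof.
elim: d => [|d IH] H; first by rewrite addn0 addr0.
rewrite addnS heightS IH; last by move=> i ij; apply: H; lia.
by rewrite (negbTE (H _ _)); lia.
Qed.

(** The record climbs along the run of 0s starting at [j]; the second to last 0 of that run is the
    required [m]. *)
Lemma double_record_init e u j : (u <= j)%N -> ~~ e j -> ~~ e j.+1 ->
  (forall i, (i <= j)%N -> height e i <= height e j) ->
  (exists2 i, (j.+1 < i)%N & e i) -> exists m, double_record e u m.
Proof.
move=> uj ej ej1 hj ex2.
have ex : exists d, e (j.+2 + d)%N.
  by case: ex2 => i ji ei; exists (i - j.+2)%N; rewrite subnKC.
pose d := ex_minn ex; have [ed dmin] : e (j.+2 + d)%N /\
    forall i, e (j.+2 + i)%N -> (d <= i)%N by rewrite /d; case: ex_minnP.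
have z i : (j <= i < j.+2 + d)%N -> ~~ e i.
  move=> /andP[ji id].
  have [->//|nj] := eqVneq i j; have [->//|nj1] := eqVneq i j.+1.
  apply/negP => ei; have := dmin (i - j.+2)%N.
  by rewrite subnKC ?ei; [move=> /(_ isT)|]; lia.
have hd i : (i <= d.+2)%N -> height e (j + i)%N = height e j + i%:Z.
  by move=> id; apply: height_zeros => k kij; apply: z; lia.
exists (j + d)%N; split; [lia|apply: z; lia|apply: z; lia| |].
  by rewrite -!addSn.
move=> i ij _; rewrite (hd d); last by lia.
have [le|lt] := leqP i j; first by have := hj i le; lia.
have := hd (i - j)%N; rewrite subnKC; last exact: ltnW.
by move=> ->; lia.
Qed.

(** The highest position up to [u] having the 0 at [z] before it is a peak. It is not [u] itself,
    because the 1 counts as an up-step and [u.+1] would be higher. *)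
Lemma back_record_init e u k0 : ~~ e u -> (k0 <= u)%N ->
  (exists2 i, (i < k0)%N & ~~ e i) -> (exists2 i, (u < i)%N & e i) ->
  (forall j, (u < j)%N -> (exists2 i, (j <= i)%N & e i) ->
     height e j <= height e k0) ->
  exists k, back_record e u k.
Proof.
move=> eu k0u [z zk ez] [i ui ei] hk.
pose P (j : 'I_u.+1) := (z < j)%N.
have k0u' : (k0 < u.+1)%N by [].
case: (@Order.TotalTheory.arg_maxP _ _ _ (Ordinal k0u') P
  (fun j : 'I_u.+1 => height e j)) => // k.
rewrite /P => zk1 kmax.
have maxk j : (j <= u)%N -> (z < j)%N -> height e j <= height e k.
  by move=> ju zj; apply: (kmax (Ordinal (ju : (j < u.+1)%N))).
have hk0 : height e k0 <= height e k by apply: maxk.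
have kP : (k.-1.+1 = k)%N by rewrite prednK //; lia.
have ku : (k < u)%N.
  have := ltn_ord k; rewrite ltnS leq_eqVlt => /orP[/eqP E|//].
  have := hk u.+1 (ltnSn u) (ex_intro2 _ _ i ui ei).
  have hE : height e k = height e u by rewrite E.
  by rewrite heightS (negbTE eu); clear -hE hk0; lia.
exists k.-1; split; rewrite ?kP //.
- apply/negP => ek.
  have zk2 : (z < k.-1)%N.
    by have : z != k.-1 by [apply: contraNneq ez => ->]; lia.
  have := maxk k.-1 ltac:(lia) zk2.
  by rewrite [height e k]height_pred ?ek; lia.
- apply/negPn/negP => ek.
  have := maxk k.+1 ku ltac:(lia).
  by rewrite heightS (negbTE ek); lia.
move=> j kj ej; have [ju|uj] := leqP j u; first by apply: maxk => //; lia.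
exact: le_trans (hk j uj ej) hk0.
Qed.

(** * The three-type dynamics with a single letter 1 *)

Section local_rule.
Implicit Types (x : nat -> nat) (i u : nat).
Local Open Scope nat_scope.

(* Letters beyond the end of a word read as 0, which makes all the boundary
   conditions in the definition of [Z] except the one at position 0 redundant. *)
Definition rule012 x i := [&& x i == 0, x i.+1 == 1 & x i.+2 == 2].

Definition rule_swap x i :=
  [&& (i == 0) || (x i <= x i.-1), x i < x i.+1 & x i.+2 <= x i.+1].

Definition rule x i : nat :=
  if rule012 x i then 0
  else if (0 < i) && rule012 x i.-1 then 2
  else if (1 < i) && rule012 x i.-2 then 1
  else if rule_swap x i then x i.+1
  else if (0 < i) && rule_swap x i.-1 then x i.-1
  else x i.

Variables (x : nat -> nat) (u : nat).
Hypotheses (x3 : forall j, x j < 3) (x1 : forall j, (x j == 1) = (j == u)).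

Let x3P j : [\/ x j = 0, x j = 1 | x j = 2].
Proof.
by move: (x3 j); case: (x j) => [|[|[|//]]] _;
  [apply: Or31|apply: Or32|apply: Or33].
Qed.

Let x1_uniq j d : ~~ ((x j == 1) && (x (j + d.+1) == 1)).
Proof. by rewrite !x1; apply/negP => /andP[/eqP-> /eqP]; lia. Qed.

(** The new letter at a place depends on the five letters within distance 2, so distances up to 4
    suffice for the case analysis. *)
Let x1_uniqS j : [/\ ~~ ((x j == 1) && (x j.+1 == 1)),
  ~~ ((x j == 1) && (x j.+2 == 1)), ~~ ((x j == 1) && (x j.+3 == 1))
  & ~~ ((x j == 1) && (x j.+4 == 1))].
Proof.
by split; [have := x1_uniq j 0|have := x1_uniq j 1|have := x1_uniq j 2|
  have := x1_uniq j 3]; rewrite ?addnS addn0.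
Qed.

(** The three ways for a 1 to arrive at [i]: exchanged with a 2 on its right, at rest, or exchanged
    with a 0 on its left. *)
Definition goes_to1 i :=
  [|| [&& 0 < i, x i.-1 == 1 & x i == 2],
      [&& x i == 1, x i.+1 != 2 & ~~ ((0 < i) && (x i.-1 == 0))]
    | [&& x i.+1 == 1, x i.+2 != 2 & x i == 0]].

Lemma rule_local i : (rule x i == 2) = flip (fun j => x j == 2) i /\
  (rule x i == 1) = goes_to1 i.
Proof.
case: i => [|[|i]].
- have := x1_uniqS 0; have := x1_uniqS 1.
  have := x3P 0; have := x3P 1; have := x3P 2.
  rewrite /rule /goes_to1 /flip /peak /rule012 /rule_swap /=.
  by case=> ->; case=> ->; case=> -> //=; move=> [? ? ? ?] [? ? ? ?].
- have := x1_uniqS 0; have := x1_uniqS 1; have := x1_uniqS 2.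
  have := x3P 0; have := x3P 1; have := x3P 2; have := x3P 3.
  rewrite /rule /goes_to1 /flip /peak /rule012 /rule_swap /=.
  by case=> ->; case=> ->; case=> ->; case=> -> //=;
    move=> [? ? ? ?] [? ? ? ?] [? ? ? ?].
have := x1_uniqS i; have := x1_uniqS i.+1; have := x1_uniqS i.+2; have := x1_uniqS i.+3.
have := x3P i; have := x3P i.+1; have := x3P i.+2; have := x3P i.+3; have := x3P i.+4.
rewrite /rule /goes_to1 /flip /peak /rule012 /rule_swap /=.
by case=> ->; case=> ->; case=> ->; case=> ->; case=> -> //=;
  move=> [? ? ? ?] [? ? ? ?] [? ? ? ?] [? ? ? ?].
Qed.

Lemma goes_to1E i : goes_to1 i = (i == move (fun j => x j == 2) u).
Proof.
rewrite /goes_to1 !x1.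
have n1 j : j != u -> (x j == 0) = (x j != 2).
  by rewrite -x1; case: (x3P j) => ->.
have S j : (j == j.+1) = false by lia.
have S2 j : (j == j.+2) = false by lia.
have S' j : (j.+1 == j) = false by lia.
have S2' j : (j.+2 == j) = false by lia.
have [->|ne1] := eqVneq i u.+1.
  rewrite /move /= eqxx /= S' S2' /= orbF; case: ifP => _; first by rewrite eqxx.
  by case: u => [|v] //=; case: ifP => _; rewrite ?S' ?S2'.
have [->|ne0] := eqVneq i u.
  rewrite /move S' /= orbF; case: (u) n1 => [|v] n1 /=.
    by rewrite !andbT; case: (x 1 == 2).
  rewrite S n1 ?S //; case: ifP => _; first by rewrite S.
  by rewrite andTb; case: ifP => _; rewrite ?S' ?eqxx.
have -> /= : [&& 0 < i, i.-1 == u & x i == 2] = false.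
  by apply/negP => /and3P[i0 /eqP iu _]; move: ne1; rewrite -iu prednK ?eqxx.
have [E|ne2] := eqVneq i.+1 u.
  rewrite -E /move /= n1; last by rewrite -E S.
  by case: ifP => _; rewrite ?S2 //=; case: ifP => _; rewrite ?eqxx ?S.
by apply/esym/negP => /eqP; rewrite /move; do 2?case: ifP => _; lia.
Qed.

End local_rule.

Section words.
Variable n : nat.
Implicit Types (w : n.-tuple 'I_3) (u i k : nat).

Definition two w i : bool := letter w i == 2.

Definition single1 w u : Prop :=
  (u < n)%N /\ forall i, (letter w i == 1) = (i == u).

Lemma letter_over w i : (n <= i)%N -> letter w i = 0.
Proof. by move=> ni; rewrite /letter nth_default // size_tuple. Qed.

Lemma rule012E w i : pat012 w i = rule012 (letter w) i.
Proof.
rewrite /pat012 /rule012 -!val_eqE /=; case: ltnP => // ni.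
by rewrite (letter_over w ni) !andbF.
Qed.

Lemma rule_swapE w i : swappable w i = rule_swap (letter w) i.
Proof.
rewrite /swappable /rule_swap; case: ltnP => [|ni] /=; last first.
  by rewrite (letter_over w ni) ltn0 /= andbF.
have [ni _|//] := eqVneq i.+2 n.
by rewrite (letter_over w (eq_leq (esym ni))) /= andbT.
Qed.

Lemma letter_Z w i : (i < n)%N -> letter (Z w) i = rule (letter w) i :> nat.
Proof.
move=> ni; rewrite /letter -[i]/(val (Ordinal ni)) nth_mktuple /=.
rewrite !rule012E !rule_swapE /rule.
by case: ifP => // _; do 4?case: ifP => // _.
Qed.

Lemma two_over w i : (n <= i)%N -> two w i = false.
Proof. by move=> ni; rewrite /two letter_over. Qed.

Lemma letter_lt3 w i : (letter w i < 3)%N. Proof. exact: ltn_ord. Qed.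

Lemma single1_nat w u : single1 w u ->
  forall i, (letter w i == 1 :> nat) = (i == u).
Proof. by move=> [_ H] i; rewrite -H -val_eqE. Qed.

Lemma single1_two w u : single1 w u -> ~~ two w u.
Proof. by move=> [_ /(_ u)]; rewrite eqxx /two => /eqP->. Qed.

Lemma two_Z w u : single1 w u -> two (Z w) = flip (two w).
Proof.
move=> wu; apply/funext => i; have [ni|ni] := ltnP i n.
  rewrite /two -val_eqE /= letter_Z //.
  by have [-> _] := rule_local (letter_lt3 w) (single1_nat wu) i.
by rewrite /flip /peak !(two_over _ ni) (two_over _ (leqW ni)) !andbF.
Qed.

Lemma move_lt w u : single1 w u -> (move (two w) u < n)%N.
Proof.
move=> [un _]; rewrite /move.
case: ifP => [tw|_]; first by rewrite ltnNge; apply: contraTN tw => /two_over->.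
by case: ifP => _ //; exact: leq_ltn_trans (leq_pred _) un.
Qed.

Lemma single1_Z w u : single1 w u -> single1 (Z w) (move (two w) u).
Proof.
move=> wu; split=> [|i]; first exact: move_lt.
have [ni|ni] := ltnP i n; last first.
  rewrite letter_over //; apply/esym/negbTE/negP => /eqP E.
  by move: (move_lt wu); rewrite -E ltnNge ni.
rewrite -val_eqE /= letter_Z //.
have [_ ->] := rule_local (letter_lt3 w) (single1_nat wu) i.
by rewrite (goes_to1E (letter_lt3 w) (single1_nat wu)).
Qed.

Lemma letter2_Pi1 w i : letter2 (Pi1 w) i = two w i.
Proof.
rewrite /letter2; have [ni|ni] := ltnP i n.
  by rewrite -[i]/(val (Ordinal ni)) nth_mktuple (tnth_nth ord0).
by rewrite nth_default ?size_tuple // two_over.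
Qed.

Lemma letter2_Z2 (e : n.-tuple bool) i : letter2 (Z2 e) i = flip (letter2 e) i.
Proof.
have over j : (n <= j)%N -> letter2 e j = false.
  by move=> nj; rewrite /letter2 nth_default // size_tuple.
have pat j : pat02 e j = ~~ letter2 e j && letter2 e j.+1.
  by rewrite /pat02; case: ltnP => // nj; rewrite (over _ nj) andbF.
rewrite {1}/letter2 /flip /peak; have [ni|ni] := ltnP i n.
  rewrite -[i]/(val (Ordinal ni)) nth_mktuple /= !pat.
  by case: ifP => // _; case: i ni.
by rewrite nth_default ?size_tuple // (over _ ni) (over _ (leqW ni)) !andbF.
Qed.

Lemma Pi1_Z w u : single1 w u -> Pi1 (Z w) = Z2 (Pi1 w).
Proof.
move=> wu; apply: val_inj; apply: (@eq_from_nth _ false); rewrite ?size_tuple // => i _.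
rewrite -!/(letter2 _ _) letter2_Z2 letter2_Pi1 (two_Z wu).
by congr flip; apply/funext => j; rewrite letter2_Pi1.
Qed.

Lemma Z2_fix_peak w : reflect (forall k, ~~ peak (two w) k)
  (Z2 (Pi1 w) == Pi1 w).
Proof.
have E : letter2 (Pi1 w) = two w by apply/funext => j; rewrite letter2_Pi1.
apply: (iffP eqP) => [fx k|np].
  apply/negP => pk; have := letter2_Z2 (Pi1 w) k; rewrite fx E /flip.
  by move: (pk) => /and3P[_ _ ->]; rewrite pk.
apply: val_inj; apply: (@eq_from_nth _ false); rewrite ?size_tuple // => i _.
by rewrite -!/(letter2 _ _) letter2_Z2 E flip_no_peak.
Qed.

End words.

(** * Stabilization times and the excess along the dynamics *)

Section stabilization_time.
Variables (A : eqType) (f : A -> A) (x : A).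
Hypothesis stab : exists k, iter k f x == iter k.+1 f x.

Lemma stab_time_fix : f x = x -> ex_minn stab = 0%N.
Proof.
by move=> fx; case: ex_minnP => -[//|k] _ /(_ 0%N); rewrite /= fx eqxx => /(_ isT).
Qed.

Lemma stab_time_step (stab' : exists k, iter k f (f x) == iter k.+1 f (f x)) :
  f x != x -> ex_minn stab = (ex_minn stab').+1.
Proof.
move=> fx; case: ex_minnP => -[|k] /eqP Hk mink.
  by case/eqP: fx; rewrite /= in Hk.
case: ex_minnP => k' /eqP Hk' mink'; congr _.+1; apply/eqP.
rewrite eqn_leq -ltnS mink ?[(k' <= k)%N]mink' //.
  by rewrite -!iterSr Hk.
by rewrite !iterSr Hk' iterSr.
Qed.

End stabilization_time.

Section excess.
Variable n : nat.
Implicit Types (w : n.-tuple 'I_3) (u i k : nat).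

Lemma excess_step w u : single1 w u -> (exists k, peak (two w) k) ->
  excess (Z w) = excess w.
Proof.
move=> wu [k pk].
have fx2 : Z2 (Pi1 w) != Pi1 w by apply/negP => /Z2_fix_peak/(_ k); rewrite pk.
have fx : Z w != w.
  by apply: contraNneq fx2 => E; rewrite -(Pi1_Z wu) E.
have TE : T w = (T (Z w)).+1 by exact: stab_time_step.
have T2E : T2 (Pi1 w) = (T2 (Z2 (Pi1 w))).+1 by exact: stab_time_step.
by rewrite /excess (Pi1_Z wu) TE T2E; lia.
Qed.

Lemma excess_sorted w : (forall k, ~~ peak (two w) k) -> excess w = (T w)%:Z.
Proof.
by move=> /Z2_fix_peak/eqP E; rewrite /excess /T2 (stab_time_fix _ E) subr0.
Qed.

(** Until the 2s are sorted both stabilization times decrease together, so the excess is [T] of the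
    word reached when they are sorted. Induction on [T2] carries the invariant there. *)
Lemma excess_invariant (I : (nat -> bool) -> nat -> Prop) (c : int) :
  (forall e u, ~~ e u -> I e u -> (exists k, peak e k) ->
     I (flip e) (move e u)) ->
  (forall w u, single1 w u -> I (two w) u ->
     (forall k, ~~ peak (two w) k) -> (T w)%:Z = c) ->
  forall w u, single1 w u -> I (two w) u -> excess w = c.
Proof.
move=> Istep Iend w u; have [k] := ubnP (T2 (Pi1 w)).
elim: k w u => // k IH w u Tk wu Iw.
have [fx2|fx2] := boolP (Z2 (Pi1 w) == Pi1 w).
  by have /Z2_fix_peak np := fx2; rewrite excess_sorted //; exact: Iend Iw np.
have ex : exists j, peak (two w) j.
  apply: contrapT => nex; move/negP: fx2; apply; apply/Z2_fix_peak => j.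
  by apply/negP => pj; apply: nex; exists j.
rewrite -(excess_step wu ex); apply: (IH _ (move (two w) u)).
- have T2E : T2 (Pi1 w) = (T2 (Z2 (Pi1 w))).+1 by exact: stab_time_step.
  by rewrite (Pi1_Z wu) -ltnS -T2E.
- exact: single1_Z.
by rewrite (two_Z wu); apply: Istep => //; exact: single1_two wu.
Qed.

Lemma letter_eq w w' u : single1 w u -> single1 w' u -> two w = two w' ->
  w = w'.
Proof.
move=> wu wu' E; apply: val_inj; apply: (@eq_from_nth _ ord0).
  by rewrite !size_tuple.
move=> i _; rewrite -!/(letter _ _); apply: val_inj.
have := congr1 (fun f => f i) E; rewrite /two -!val_eqE /=.
have := single1_nat wu i; rewrite -(single1_nat wu' i).
have := letter_lt3 w i; have := letter_lt3 w' i; rewrite /=.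
by case: (letter w i) => -[|[|[|?]]] //= ?; case: (letter w' i) => -[|[|[|?]]].
Qed.

Lemma sorted_fix w u : single1 w u -> (forall k, ~~ peak (two w) k) ->
  move (two w) u = u -> Z w = w.
Proof.
move=> wu np mu; apply: (@letter_eq _ _ u) => //.
  by have := single1_Z wu; rewrite mu.
by rewrite (two_Z wu); apply/funext => i; exact: flip_no_peak.
Qed.

Lemma front_fix e u : ~~ e u -> front e u -> (forall k, ~~ peak e k) ->
  move e u = u.
Proof.
move=> eu fr np; rewrite /move; case: ifP => [e1|_].
  by have := np u.+1; rewrite /peak /= eu e1.
by case: u eu fr => //= u _ fr; rewrite fr.
Qed.

Lemma front_T w u : single1 w u -> front (two w) u ->
  (forall k, ~~ peak (two w) k) -> (T w)%:Z = 0.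
Proof.
move=> wu fr np; rewrite /T stab_time_fix //; apply: (sorted_fix wu np).
exact: front_fix (single1_two wu) fr np.
Qed.

(** Once sorted, no 0 precedes the last 2, which rules out distance 1; at distance 2 a single
    exchange with a 0 remains. *)
Lemma trailing_T w u : single1 w u -> trailing (two w) u ->
  (forall k, ~~ peak (two w) k) -> (T w)%:Z = 1.
Proof.
move=> wu [l [el lP ul]] np.
have below i : (i <= l)%N -> two w i.
  move=> il; apply/negPn/negP => ei.
  have [m] := ubnP (l - i)%N; elim: m i il ei => // m IH i il ei lim.
  have [E|ne] := eqVneq i l; first by rewrite E el in ei.
  have [e1|e1] := boolP (two w i.+1).
    by have := np i.+1; rewrite /peak /= ei e1.
  by apply: (IH i.+1) => //; lia.
have {ul} ul : u = l.+2 by case: ul => // -[_ [i il]]; rewrite below // ltnW.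
have two' : two (Z w) = two w.
  by rewrite (two_Z wu); apply/funext => i; exact: flip_no_peak.
have mv : move (two w) u = l.+1.
  by rewrite ul /move (negbTE (lP l.+3 _)) /= ?(lP l.+1) //; lia.
have wu' : single1 (Z w) l.+1 by rewrite -mv; exact: single1_Z.
have fx : Z w != w.
  apply/negP => /eqP E; case: wu' => _ /(_ u); case: wu => _ /(_ u).
  by rewrite E => ->; rewrite eqxx ul; lia.
rewrite /T (stab_time_step _ (Z_stab (Z w)) fx) stab_time_fix //.
apply: (sorted_fix wu'); rewrite two' //.
apply: front_fix np; first by rewrite -two'; exact: single1_two wu'.
by move=> i; rewrite ltnS; exact: below.
Qed.

(** The invariant is [front] or [double_record]. A double record contains a peak, so a sorted word
    can only be in the [front] state. *)
Lemma excess0 w u j : single1 w u -> (u <= j)%N -> ~~ two w j ->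
  ~~ two w j.+1 -> (forall i, (i <= j)%N -> height (two w) i <= height (two w) j) ->
  (exists2 i, (j.+1 < i)%N & two w i) -> excess w = 0.
Proof.
move=> wu uj ej ej1 hj ex2.
pose I e u := front e u \/ exists m, double_record e u m.
apply: (@excess_invariant I 0 _ _ w u) => //.
- move=> e v ev [fr|[m dm]] _; first by left; exact: front_step.
  exact: double_record_step dm.
- move=> w' v wv [|[m [_ _ em1 em2 _]] np]; first exact: front_T.
  by have := np m.+2; rewrite /peak /= em1 em2.
by right; exact: double_record_init ex2.
Qed.

Lemma excess1 w u k : single1 w u -> (k <= u)%N ->
  (exists2 i, (i < k)%N & ~~ two w i) -> (exists2 i, (u < i)%N & two w i) ->
  (forall j, (u < j)%N -> (exists2 i, (j <= i)%N & two w i) ->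
     height (two w) j <= height (two w) k) -> excess w = 1.
Proof.
move=> wu ku ez e2 hk.
pose I e u := (exists k, back_record e u k /\ exists2 i, (u < i)%N & e i)
  \/ trailing e u.
apply: (@excess_invariant I 1 _ _ w u) => //.
- move=> e v ev [[m [bm em]]|tr] pk; first exact: back_record_step bm em.
  by right; exact: trailing_step.
- move=> w' v wv [[m [[_ em em1 _] _]] np|]; last exact: trailing_T.
  by have := np m.+1; rewrite /peak /= em em1.
left; have [m bm] := back_record_init (single1_two wu) ku ez e2 hk.
by exists m.
Qed.

End excess.

(** * Random words *)

Section coin_expectation.
Variable R : realFieldType.
Implicit Types (p : R) (f g : seq bool -> R) (m n : nat) (s x y : seq bool).

(* Expectation of [f] over words of [n] independent letters, each [true] with
   probability [p]. *)
Fixpoint coin_exp p n f : R :=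
  if n is n'.+1 then p * coin_exp p n' (fun s => f (true :: s))
                     + (1 - p) * coin_exp p n' (fun s => f (false :: s))
  else f [::].

Lemma eq_coin_exp p n f g : (forall s, size s = n -> f s = g s) ->
  coin_exp p n f = coin_exp p n g.
Proof.
elim: n f g => [|n IH] f g fg /=; first exact: fg.
by congr (_ * _ + _ * _); apply: IH => s sn; apply: fg; rewrite /= sn.
Qed.

Lemma le_coin_exp p n f g : 0 <= p <= 1 ->
  (forall s, size s = n -> f s <= g s) -> coin_exp p n f <= coin_exp p n g.
Proof.
move=> /andP[p0 p1]; elim: n f g => [|n IH] f g fg /=; first exact: fg.
by apply: lerD; apply: ler_wpM2l; rewrite ?subr_ge0 //; apply: IH => s sn;
  apply: fg; rewrite /= sn.
Qed.

Lemma coin_exp_cst p n (c : R) : coin_exp p n (fun=> c) = c.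
Proof. by elim: n => //= n ->; ring. Qed.

Lemma coin_expD p n f g :
  coin_exp p n (fun s => f s + g s) = coin_exp p n f + coin_exp p n g.
Proof. by elim: n f g => [//|n IH] f g /=; rewrite !IH; ring. Qed.

Lemma coin_expZ p n (c : R) f :
  coin_exp p n (fun s => c * f s) = c * coin_exp p n f.
Proof. by elim: n f => [//|n IH] f /=; rewrite !IH; ring. Qed.

Lemma coin_expB p n f g :
  coin_exp p n (fun s => f s - g s) = coin_exp p n f - coin_exp p n g.
Proof. by elim: n f g => [//|n IH] f g /=; rewrite !IH; ring. Qed.

Lemma coin_exp_ge0 p n f : 0 <= p <= 1 -> (forall s, 0 <= f s) ->
  0 <= coin_exp p n f.
Proof.
by move=> p01 f0; rewrite -[0](coin_exp_cst p n); apply: le_coin_exp.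
Qed.

Lemma coin_exp_cat p m n f : coin_exp p (m + n) f =
  coin_exp p m (fun x => coin_exp p n (fun y => f (x ++ y))).
Proof. by elim: m f => [//|m IH] f; rewrite addSn /= !IH. Qed.

Lemma coin_exp_rcons p n f : coin_exp p n.+1 f =
  p * coin_exp p n (fun s => f (rcons s true))
  + (1 - p) * coin_exp p n (fun s => f (rcons s false)).
Proof.
rewrite -addn1 coin_exp_cat /= -!coin_expZ -coin_expD.
by apply: eq_coin_exp => s _; rewrite !cats1.
Qed.

Lemma coin_exp_rev p n f : coin_exp p n (fun s => f (rev s)) = coin_exp p n f.
Proof.
elim: n f => [//|n IH] f; rewrite [RHS]coin_exp_rcons /=.
rewrite -(IH (fun s => f (rcons s true))) -(IH (fun s => f (rcons s false))).
by congr (_ * _ + _ * _); apply: eq_coin_exp => s _; rewrite rev_cons.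
Qed.

Lemma coin_exp_negb p n f :
  coin_exp p n (fun s => f (map negb s)) = coin_exp (1 - p) n f.
Proof.
by elim: n f => [//|n IH] f /=; rewrite !(IH (fun s => f (_ :: s))); ring.
Qed.

Lemma coin_exp_exchange p (q : R) m n (f : seq bool -> seq bool -> R) :
  coin_exp p m (fun x => coin_exp q n (fun y => f x y)) =
  coin_exp q n (fun y => coin_exp p m (fun x => f x y)).
Proof. by elim: m f => [//|m IH] f /=; rewrite !IH -!coin_expZ -coin_expD. Qed.

Lemma coin_exp_all_true p n : coin_exp p n (fun s => (false \notin s)%:R) = p ^+ n.
Proof.
elim: n => [//|n IH] /=; rewrite exprS -IH -[RHS]addr0; congr (_ + _).
rewrite (_ : coin_exp _ _ _ = 0) ?mulr0 //.
by rewrite -[RHS](coin_exp_cst p n); apply: eq_coin_exp.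
Qed.

Lemma coin_exp_all_false p n :
  coin_exp p n (fun s => (true \notin s)%:R) = (1 - p) ^+ n.
Proof.
rewrite -coin_exp_all_true -coin_exp_negb; apply: eq_coin_exp => s _.
by rewrite -[false]/(~~ true) mem_map //; exact: negb_inj.
Qed.

Definition zeros_count s : nat := count negb s.

(** Each letter adds an independent centred term of variance [p * (1 - p)]. This controls the random
    number of places available to the 1. *)
Lemma coin_exp_variance p n :
  coin_exp p n (fun s => ((zeros_count s)%:R - (1 - p) * n%:R) ^+ 2) =
  p * (1 - p) * n%:R.
Proof.
elim: n => [|n IH] /=; first by rewrite !mulr0 subrr expr0n.
rewrite -[n.+1%:R]natr1 [RHS]mulrDr -IH mulr1 -[X in _ = _ + X](coin_exp_cst p n).
rewrite -!coin_expZ -!coin_expD; apply: eq_coin_exp => s _.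
by rewrite /zeros_count /= add0n natrD; ring.
Qed.

End coin_expectation.

Section running_maximum.
Implicit Types (d : nat) (s x y : seq bool).

(** Maximum of the path, starting height 0 included, computed from the first step; the truncated
    predecessor is the maximum with 0. *)
Fixpoint run_max s : nat :=
  if s is b :: s' then if b then (run_max s').-1 else (run_max s').+1 else 0%N.

(* Distance of the end of the path of [x] below its maximum. *)
Definition depth x : nat := run_max (map negb (rev x)).

Lemma depth_rcons x b :
  depth (rcons x b) = if b then (depth x).+1 else (depth x).-1.
Proof. by rewrite /depth rev_rcons /=; case: b. Qed.

(* Continuing with [s] from [d] below the running maximum, no weak record is
   followed by two up-steps. *)
Fixpoint no_double_record d s : bool :=
  if s is b :: s' then
    if b then no_double_record d.+1 s'
    else if d is d'.+1 then no_double_record d' s'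
    else head true s' && no_double_record 0 s'
  else true.

End running_maximum.

(** * Survival probabilities and maxima of random walks *)

Section survival.
Variable R : realFieldType.
Implicit Types (n d k : nat).

(* Probability that a simple symmetric random walk started at [d] stays positive
   during [n] steps. *)
Fixpoint survival n d : R :=
  if d is d'.+1 then
    if n is n'.+1 then 2^-1 * (survival n' d' + survival n' d'.+2) else 1
  else 0.

Lemma survival_d0 n : survival n 0 = 0. Proof. by case: n. Qed.

Lemma survivalS n d :
  survival n.+1 d.+1 = 2^-1 * (survival n d + survival n d.+2).
Proof. by []. Qed.

Lemma survival_n0 d : survival 0 d.+1 = 1. Proof. by []. Qed.

Lemma survival_ge0 n d : 0 <= survival n d.
Proof.
elim: n d => [|n IH] [|d] //; rewrite survivalS.
by have := IH d; have := IH d.+2; lra.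
Qed.

Lemma survival_le1 n d : survival n d <= 1.
Proof.
elim: n d => [|n IH] [|d] //; rewrite survivalS.
by have := IH d; have := IH d.+2; lra.
Qed.

(** The recursion preserves concavity in the starting point. Hence every increment is at most the
    first one, [survival n 1]. *)
Lemma survival_concave n d :
  survival n d + survival n d.+2 <= 2 * survival n d.+1.
Proof.
elim: n d => [|n IH] [|d]; rewrite ?survival_n0 ?survival_d0; try lra.
  by rewrite !survivalS survival_d0; have := IH 1%N; lra.
by rewrite !survivalS; have := IH d; have := IH d.+2; lra.
Qed.

Lemma survival_leS n d : survival n d <= survival n d.+1.
Proof.
elim: n d => [|n IH] [|d]; rewrite ?survival_d0 ?survival_ge0 //.
by rewrite !survivalS; have := IH d; have := IH d.+2; lra.
Qed.

Lemma survival_mono n d k : (d <= k)%N -> survival n d <= survival n k.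
Proof.
move=> dk; rewrite -(subnKC dk); elim: (k - d)%N => [|j IH].
  by rewrite addn0.
by rewrite addnS (le_trans IH) // survival_leS.
Qed.

Lemma survival_incr n d : survival n d.+1 <= survival n d + survival n 1.
Proof.
elim: d => [|d IH]; first by rewrite survival_d0 add0r.
by have := survival_concave n d; lra.
Qed.

Lemma survival_addr n d k :
  survival n (d + k) <= survival n d + k%:R * survival n 1.
Proof.
elim: k => [|k IH]; first by rewrite addn0 mul0r addr0.
by rewrite addnS (le_trans (survival_incr _ _)) // -natr1 mulrDl mul1r addrA lerD2r.
Qed.

Lemma survival_le_linear n d : survival n d <= d%:R * survival n 1.
Proof. by have := survival_addr n 0 d; rewrite survival_d0 add0r. Qed.

Lemma survival_decr n d : survival n.+1 d <= survival n d.
Proof.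
case: d => [|d]; first by rewrite !survival_d0.
by rewrite survivalS; have := survival_concave n d; lra.
Qed.

(** During [k] steps the walk loses at most [k]. *)
Lemma survival_shift n d k : survival n d <= survival (n + k) (d + k).
Proof.
elim: k => [|k IH]; first by rewrite !addn0.
rewrite !addnS (le_trans IH) // survivalS.
have := survival_mono (n + k) (leqnSn (d + k)%N).
by have := survival_mono (n + k) (leqnSn (d + k).+1); lra.
Qed.

(** The distance from the path up to level [d] is a walk that must stay positive. For [p] at most
    1/2 it is biased downwards, and monotonicity in [d] compares it with the symmetric walk. *)
Lemma run_max_survival (p : R) n d : 0 <= p <= 2^-1 ->
  coin_exp p n (fun s => (run_max s < d)%N%:R) <= survival n d.
Proof.
move=> /andP[p0 p2]; elim: n d => [|n IH] [|d] //=.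
  by rewrite !coin_exp_cst; lra.
rewrite (eq_coin_exp (g := fun s => (run_max s < d.+2)%N%:R) p (n := n)); last first.
  by move=> s _; congr (_%:R); lia.
have := IH d; have := IH d.+2; have := survival_mono n (leqW (leqnSn d)).
nra.
Qed.

Lemma run_max_survival_half n d :
  coin_exp (2^-1 : R) n (fun s => (run_max s < d)%N%:R) = survival n d.
Proof.
elim: n d => [|n IH] [|d] //=; first by rewrite !coin_exp_cst; lra.
rewrite (eq_coin_exp (g := fun s => (run_max s < d.+2)%N%:R) _ (n := n)); last first.
  by move=> s _; congr (_%:R); lia.
by rewrite !IH; lra.
Qed.

(** Gambler's ruin: powers of [(1 - p) / p] solve the recursion obtained from the first step. *)
Lemma run_max_tail (p : R) n k : 0 < p -> p <= 1 ->
  coin_exp p n (fun s => (k <= run_max s)%N%:R) <= ((1 - p) / p) ^+ k.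
Proof.
move=> p0 p1; elim: n k => [|n IH] [|k] /=.
- by rewrite expr0.
- by apply: exprn_ge0; apply: divr_ge0; lra.
- by rewrite !coin_exp_cst expr0; lra.
rewrite (eq_coin_exp (g := fun s => (k.+2 <= run_max s)%N%:R) p (n := n)); last first.
  by move=> s _; congr (_%:R); lia.
have -> : ((1 - p) / p) ^+ k.+1 =
    p * ((1 - p) / p) ^+ k.+2 + (1 - p) * ((1 - p) / p) ^+ k.
  rewrite !exprS; move: (_ ^+ k) => t; field; exact: lt0r_neq0.
by apply: lerD; apply: ler_wpM2l; rewrite ?IH //; lra.
Qed.

(* [survival n (d + 3)] is a supersolution of the recursion satisfied by the left
   hand side; by concavity in [d], the shift 3 is enough at [d = 0]. *)
Lemma no_double_record_survival (p : R) n d : 0 <= p <= 2^-1 ->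
  coin_exp p n (fun s => (no_double_record d s)%:R) <= survival n (d + 3).
Proof.
move=> /andP[p0 p2]; have [k] := ubnP n; elim: k n d => // k IH [|n] d nk.
  by rewrite addn3.
case: d => [|d] /=; last first.
  have := IH n d.+2 nk; have := IH n d nk; rewrite !addSn addn3.
  have := survival_mono n (leqW (leqnSn d.+3)).
  nra.
(* At depth 0 a letter 0 must be followed by a 2, which leads to depth 1 after two letters; hence
   the strong induction. *)
case: n nk => [|n] nk /=; first by lra.
rewrite coin_exp_cst mulr0 addr0.
have := IH n 1%N (ltnW nk); rewrite -[(1 + 3)%N]/4%N.
have := IH n.+1 1%N nk; rewrite /=.
set a := coin_exp _ _ (fun s => (no_double_record 1 s)%:R); set b := _ * _ + _ => hb ha.
(* After two unfoldings of the bound at 3, this is exactly the inequality that remains. *)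
have h3 : survival n 4 <= survival n 1 + survival n 3.
  by have := survival_incr n 3; lra.
have pa : (1 - p) * (p * a) <= 4^-1 * survival n 4.
  have pq : (1 - p) * p <= 4^-1 by nra.
  rewrite mulrA; apply: le_trans (_ : (1 - p) * p * survival n 4 <= _).
    by apply: ler_wpM2l => //; apply: mulr_ge0; lra.
  exact: ler_wpM2r (survival_ge0 _ _) _ _ pq.
have pb : p * b <= 2^-1 * (2^-1 * (survival n 3 + survival n 5)).
  apply: le_trans (_ : p * (2^-1 * (survival n 3 + survival n 5)) <= _).
    exact: ler_wpM2l.
  apply: ler_wpM2r => //.
  by have := survival_ge0 n 3; have := survival_ge0 n 5; lra.
lra.
Qed.

End survival.

Section survival_limit.
Variable R : realType.

(* The limits over [n] form a bounded sequence in [d] which is harmonic and vanishes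
   at 0, hence is zero. *)
Lemma survival_cvg0 (eps : R) : 0 < eps ->
  exists K, forall n, (K <= n)%N -> survival R n 1 <= eps.
Proof.
move=> eps0.
pose v (d n : nat) : R := survival R n d.
have dec d : nonincreasing_seq (v d).
  by apply/nonincreasing_seqP => n; exact: survival_decr.
have cv d : cvgn (v d).
  apply: nonincreasing_is_cvgn (dec d) _.
  by exists 0 => _ [n _ <-]; exact: survival_ge0.
pose b d : R := limn (v d).
have bP d : (v d n @[n --> \oo] --> b d) by exact: cv.
have bS d : b d.+1 = 2^-1 * (b d + b d.+2).
  have h1 : (v d.+1 n.+1 @[n --> \oo] --> b d.+1).
    by rewrite (@cvg_shiftS _ (v d.+1)); exact: bP.
  have h2 : (2^-1 * (v d n + v d.+2 n) @[n --> \oo] -->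
      2^-1 * (b d + b d.+2)).
    by apply: cvgMr; apply: cvgD; exact: bP.
  exact: cvg_unique h1 h2.
have b0 : b 0%N = 0.
  rewrite /b; apply/cvg_lim => //.
  by apply: cvg_near_cst; near=> n; exact: survival_d0.
have bl d : b d = d%:R * b 1%N.
  have [k] := ubnP d; elim: k d => // k IH [|[|d]] dk.
  - by rewrite b0 mul0r.
  - by rewrite mul1r.
  have -> : b d.+2 = 2 * b d.+1 - b d by have := bS d; lra.
  by rewrite (IH d) ?(IH d.+1) -?[d.+2%:R]natr1 -?[d.+1%:R]natr1; [ring|lia..].
have ble d : b d <= 1.
  by apply: limr_le => //; apply: nearW => n; exact: survival_le1.
have b1 : b 1%N < eps.
  have [//|le] := ltP (b 1%N) eps.
  (* By linearity [b d] is at least [d%:R * eps], which for this [d] exceeds the bound 1. *)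
  pose d := Num.bound eps^-1.
  have hd : eps^-1 < d%:R by apply: archi_boundP; rewrite invr_ge0 ltW.
  have := ble d; rewrite bl.
  have : 1 < d%:R * eps by rewrite -ltr_pdivrMr // div1r.
  have d0 : 0 <= d%:R :> R by [].
  nra.
have : (\forall n \near \oo, v 1%N n < eps).
  exact: cvgr_lt (b 1%N) (bP 1%N) eps b1.
by move=> [K _ HK]; exists K => n Kn; apply/ltW/HK.
Unshelve. all: by end_near. Qed.

End survival_limit.

(** * Excess of a word x 1 y *)

Section sequence_heights.
Implicit Types (s x y : seq bool) (i j k : nat).

Local Notation h s := (height (nth false s)).

Lemma eq_height (e e' : nat -> bool) k : (forall i, (i < k)%N -> e i = e' i) ->
  height e k = height e' k.
Proof.
elim: k => // k IH ee; rewrite !heightS ee // IH // => i ik.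
by apply: ee; exact: ltnW.
Qed.

Lemma height_catl x y k : (k <= size x)%N -> h (x ++ y) k = h x k.
Proof.
by move=> kx; apply: eq_height => i ik; rewrite nth_cat (leq_trans ik kx).
Qed.

Lemma height_rconsl x b k : (k <= size x)%N -> h (rcons x b) k = h x k.
Proof. by rewrite -cats1; exact: height_catl. Qed.

Lemma height_rcons x b :
  h (rcons x b) (size x).+1 = h x (size x) + (if b then -1 else 1).
Proof. by rewrite heightS height_rconsl // nth_rcons ltnn eqxx. Qed.

Lemma depth_bound x i : (i <= size x)%N ->
  h x i <= h x (size x) + (depth x)%:Z.
Proof.
elim/last_ind: x i => [|x b IH] i.
  by rewrite leqn0 => /eqP->.
rewrite size_rcons height_rcons depth_rcons leq_eqVlt => /orP[/eqP->|ix].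
  by rewrite height_rcons; lia.
have := IH i ix; rewrite height_rconsl //.
by case: b; case: (depth x); lia.
Qed.

Lemma depth_attained x1 x2 : exists2 i, (i <= size x2)%N &
  h (x1 ++ x2) (size x1 + i)%N =
    h (x1 ++ x2) (size x1 + size x2)%N + (depth x2)%:Z.
Proof.
elim/last_ind: x2 => [|x b [i ix IH]].
  by exists 0%N => //; rewrite addr0.
rewrite size_rcons depth_rcons -rcons_cat addnS -size_cat height_rcons size_cat.
have H j : (j <= size x)%N ->
    h (rcons (x1 ++ x) b) (size x1 + j)%N = h (x1 ++ x) (size x1 + j)%N.
  by move=> jx; rewrite height_rconsl // size_cat leq_add2l.
case: b H => H; first by exists i; [exact: leqW|rewrite H // IH; lia].
case: (depth x) IH => [|d] IH /=; last first.
  by exists i; [exact: leqW|rewrite H // IH; lia].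
exists (size x).+1 => //.
by rewrite addnS -size_cat height_rcons size_cat addr0.
Qed.

Lemma run_max_bound x y k : (k <= size y)%N ->
  h (x ++ y) (size x + k)%N <= h (x ++ y) (size x) + (run_max y)%:Z.
Proof.
elim: y x k => [|b y IH] x [|k] //=; rewrite ?addn0 => ky; try lia.
have := IH (rcons x b) k ky; rewrite cat_rcons size_rcons addSnnS.
rewrite heightS nth_cat ltnn subnn /=.
by case: b {IH}; case: (run_max y) => /=; lia.
Qed.

(** Letters pass from [s] to the end of [x], so [depth x] remains the distance to the running
    maximum. At depth 0 the current position is a weak record. *)
Lemma no_double_recordPn x s : ~~ no_double_record (depth x) s ->
  exists j, [/\ (size x <= j)%N, (j.+1 < size x + size s)%N,
    ~~ nth false (x ++ s) j, ~~ nth false (x ++ s) j.+1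
    & forall i, (i <= j)%N -> h (x ++ s) i <= h (x ++ s) j].
Proof.
elim: s x => [|b s IH] x //= nd.
have {}IH : ~~ no_double_record (depth (rcons x b)) s -> exists j, [/\ (size x <= j)%N,
    (j.+1 < size x + (size s).+1)%N,
    ~~ nth false (x ++ b :: s) j, ~~ nth false (x ++ b :: s) j.+1
    & forall i, (i <= j)%N -> h (x ++ b :: s) i <= h (x ++ b :: s) j].
  move=> /IH[j]; rewrite cat_rcons size_rcons addSnnS => -[xj js ej ej1 hj].
  by exists j; split=> //; exact: ltnW.
rewrite depth_rcons in IH; case: b nd IH => [nd|]; first exact.
case E: (depth x) => [|d] nd; last exact.
rewrite negb_and in nd; case/orP: nd => [|nd]; last exact.
case: s => [//|[//|s]] _ _; exists (size x).
split; rewrite ?nth_cat ?ltnn ?subnn //=; [lia| |].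
  by rewrite ltnNge leqnSn subSnn.
move=> i ix; rewrite !height_catl //.
by have := depth_bound ix; rewrite E addr0.
Qed.

End sequence_heights.

Section excess_of_sequences.
Variable n : nat.
Implicit Types (w : n.-tuple 'I_3) (x y : seq bool).

Lemma excess0_seq w x y1 y2 : single1 w (size x) ->
  two w = nth false (x ++ false :: y1 ++ y2) ->
  ~~ no_double_record (depth x) (false :: y1) -> true \in y2 -> excess w = 0.
Proof.
move=> wu wE /no_double_recordPn[j [xj js ej ej1 hj]] t2.
have sE : x ++ false :: y1 ++ y2 = (x ++ false :: y1) ++ y2 by rewrite -catA.
have szE : size (x ++ false :: y1) = (size x + (size y1).+1)%N by rewrite size_cat.
rewrite /= -szE in js.
apply: (@excess0 _ w (size x) j) => //; rewrite wE sE.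
- by rewrite nth_cat (ltnW js).
- by rewrite nth_cat js.
- have jle := ltnW (ltnW js); move=> i ij.
  by rewrite (height_catl _ jle) (height_catl _ (leq_trans ij jle)) hj.
exists (size (x ++ false :: y1) + index true y2)%N.
  exact: leq_trans js (leq_addr _ _).
by rewrite nth_cat ltnNge leq_addr addKn nth_index.
Qed.

(** The 1 is itself an up-step, so heights after it exceed the height at the 1 by at most
    [1 + run_max y]; this is why the inequality is strict. *)
Lemma excess1_seq w x1 x2 y : single1 w (size (x1 ++ x2)) ->
  two w = nth false ((x1 ++ x2) ++ false :: y) ->
  false \in x1 -> true \in y -> (run_max y < depth x2)%N -> excess w = 1.
Proof.
move=> wu wE f1 t2 lt; have [k kx hk] := depth_attained x1 x2.
have kle : (size x1 + k <= size (x1 ++ x2))%N by rewrite size_cat leq_add2l.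
apply: (@excess1 _ w (size (x1 ++ x2)) (size x1 + k)%N) => //; rewrite wE.
- exists (index false x1); first by rewrite ltn_addr // index_mem.
  by rewrite -catA nth_cat index_mem f1 nth_index.
- exists (size (x1 ++ x2) + (index true y).+1)%N; first by lia.
  by rewrite nth_cat ltnNge leq_addr addKn /= nth_index.
move=> j uj [i ji ei].
have jy : (j <= size ((x1 ++ x2) ++ false :: y))%N.
  apply: leq_trans ji _; rewrite leqNgt; apply: contraTN ei => si.
  by rewrite nth_default // ltnW.
rewrite [X in _ <= X]height_catl // hk -size_cat.
have E : (x1 ++ x2) ++ false :: y = rcons (x1 ++ x2) false ++ y by rewrite cat_rcons.
have := @run_max_bound (rcons (x1 ++ x2) false) y (j - (size (x1 ++ x2)).+1)%N.
rewrite size_rcons subnKC // -E => H.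
rewrite size_cat /= in jy; have {H} := H ltac:(lia).
rewrite heightS nth_cat ltnn subnn /=.
rewrite [height (nth false (_ ++ _ :: _)) (size _)]height_catl //.
by move=> h1; apply: le_trans h1 _; lia.
Qed.

End excess_of_sequences.

(* The last (resp. first) [L] letters are set aside to provide a 2 after the double
   record (resp. a 0 before the maximum). *)
Definition overtakes (L : nat) (x y : seq bool) : bool :=
  ~~ no_double_record (depth x) (false :: take (size y - L) y)
  && (true \in drop (size y - L) y).

Definition is_overtaken (L : nat) (x y : seq bool) : bool :=
  [&& false \in take L x, true \in y & (run_max y < depth (drop L x))%N].

(* Conditional probability of [good], given that the 1 is preceded by [i] and
   followed by [n] letters. *)
Definition success (R : realFieldType) (p : R) (good : seq bool -> seq bool -> bool)
    (i n : nat) : R :=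
  coin_exp p i (fun x => coin_exp p n (fun y => (good x y)%:R)).

(** * Probabilities of the two deciding configurations *)

Section success_bounds.
Variable R : realFieldType.
Implicit Types (p : R) (i n k L : nat).

(** Read backwards from its end, with the roles of the letters exchanged, a Bernoulli word of
    parameter [p] becomes one of parameter [1 - p]. *)
Lemma coin_exp_depth p n (f : nat -> R) :
  coin_exp p n (fun s => f (depth s)) = coin_exp (1 - p) n (fun s => f (run_max s)).
Proof.
rewrite /depth (coin_exp_rev p n (fun s => f (run_max (map negb s)))).
exact: (coin_exp_negb p n (fun s => f (run_max s))).
Qed.

Lemma sub_coin_exp_le p n (c d : R) (f g : seq bool -> R) : 0 <= p <= 1 ->
  (forall s, size s = n -> c - f s - d <= g s) ->
  c - coin_exp p n f - d <= coin_exp p n g.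
Proof. by move=> p01 /(le_coin_exp p01); rewrite !coin_expB !coin_exp_cst. Qed.

(** Union bound over two failures: no double record within the first [n] letters of the right side,
    or no 2 among its last [L]. *)
Lemma overtakes_ge p L i n : 0 <= p <= 2^-1 ->
  1 - coin_exp p i (fun x => survival R n (depth x + 3)) - (1 - p) ^+ L
    <= success p (overtakes L) i (n + L).
Proof.
move=> /andP[p0 p2]; have p01 : 0 <= p <= 1 by lra.
apply: sub_coin_exp_le => // x _; rewrite coin_exp_cat.
have nd : coin_exp p n (fun y1 => (no_double_record (depth x) (false :: y1))%:R)
    <= survival R n (depth x + 3).
  (* The 1, read as a 0, lowers the depth by one, unless it is already 0. *)
  apply: le_trans (_ : survival R n ((depth x).-1 + 3) <= _); last first.
    by apply: survival_mono; lia.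
  apply: le_trans (no_double_record_survival n _ (_ : 0 <= p <= 2^-1)); last by lra.
  apply: le_coin_exp => // y _; rewrite ler_nat /=.
  by case: (depth x) => //=; case: (head _ _).
apply: le_trans (_ : 1 - coin_exp p n (fun y1 =>
  (no_double_record (depth x) (false :: y1))%:R) - (1 - p) ^+ L <= _).
  by rewrite lerD2r lerD2l lerN2.
apply: sub_coin_exp_le => // y1 s1.
rewrite -(coin_exp_all_false p L) -[leLHS]subr0.
apply: sub_coin_exp_le => // y2 s2.
rewrite /overtakes size_cat s1 s2 addnK -s1 take_size_cat // drop_size_cat //.
by case: (no_double_record _ _); case: (true \in y2) => /=; lra.
Qed.

Lemma is_overtaken_ge p L i n : 2^-1 <= p <= 1 ->
  1 - coin_exp p n (fun y => survival R i (run_max y).+1) - p ^+ L - (1 - p) ^+ n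
    <= success p (is_overtaken L) (L + i) n.
Proof.
move=> /andP[p2 p1]; have p01 : 0 <= p <= 1 by lra.
apply: le_trans (_ : 1 - coin_exp p n (fun y =>
    coin_exp p i (fun x2 => (depth x2 < (run_max y).+1)%N%:R))
    - p ^+ L - (1 - p) ^+ n <= _).
  rewrite !lerD2r lerD2l lerN2; apply: le_coin_exp => // y _.
  rewrite (coin_exp_depth p i (fun d => (d < _)%N%:R)).
  by apply: run_max_survival; lra.
rewrite -coin_exp_exchange /success coin_exp_cat.
rewrite -(coin_exp_all_true p L) addrAC.
set A := coin_exp p i _; set C := (1 - p) ^+ n.
rewrite -[leLHS]subr0.
apply: sub_coin_exp_le => // x1 s1; rewrite subr0.
have -> : 1 - A - C - (false \notin x1)%:R = 1 - C - (false \notin x1)%:R - A - 0.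
  by ring.
apply: sub_coin_exp_le => // x2 s2; rewrite subr0.
set D := coin_exp p n (fun y => (depth x2 < _)%N%:R).
have -> : 1 - C - (false \notin x1)%:R - D = 1 - (false \notin x1)%:R
    - coin_exp p n (fun y => (true \notin y)%:R + (depth x2 < (run_max y).+1)%N%:R) - 0.
  by rewrite coin_expD coin_exp_all_false -/C -/D; ring.
apply: sub_coin_exp_le => // y _.
rewrite /is_overtaken -s1 take_size_cat // drop_size_cat // ltnS ltnNge.
by case: (false \in x1); case: (true \in y); case: (depth x2 <= _)%N => /=; lra.
Qed.

(** Split at [run_max s = k]: the geometric tail above, the linear bound on survival below. *)
Lemma survival_tail p i n k : 2^-1 <= p <= 1 ->
  coin_exp p i (fun s => survival R n (run_max s + 3)) <=
  ((1 - p) / p) ^+ k + (k + 3)%:R * survival R n 1.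
Proof.
move=> /andP[p2 p1].
apply: le_trans (_ : coin_exp p i (fun s => (k <= run_max s)%N%:R +
    (k + 3)%:R * survival R n 1) <= _); last first.
  by rewrite coin_expD coin_exp_cst lerD2r; apply: run_max_tail; lra.
apply: le_coin_exp => [|s _]; first by lra.
case: leqP => ks.
  apply: le_trans (survival_le1 _ _ _) _.
  by rewrite lerDl mulr_ge0 ?survival_ge0.
rewrite add0r; apply: le_trans (survival_le_linear _ _ _).
by apply: survival_mono; lia.
Qed.

(* Probability that a path of length [i] does not exceed the maximum of an
   independent path of length [n]. *)
Definition max_le_mass i n : R :=
  coin_exp 2^-1 n (fun y => survival R i (run_max y).+1).

(** The two masses together cover every outcome once and ties twice. A tie costs an increment of
    [survival i], hence at most [survival R i 1]. *)
Lemma max_le_massD i n : max_le_mass i n + max_le_mass n i <= 1 + survival R i 1.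
Proof.
have h01 : 0 <= (2^-1 : R) <= 1 by rewrite invr_ge0 ler0n invf_le1 ?ltr0n ?ler1n.
have E j m : max_le_mass j m = coin_exp 2^-1 m (fun y =>
    coin_exp 2^-1 j (fun x => (run_max x <= run_max y)%N%:R)).
  by apply: eq_coin_exp => y _; rewrite -run_max_survival_half.
rewrite (E n i) coin_exp_exchange E -coin_expD.
rewrite -[leRHS](coin_exp_cst 2^-1 n); apply: le_coin_exp => // y _.
rewrite -coin_expD; apply: le_trans (_ : coin_exp 2^-1 i (fun x => 1 +
  ((run_max x < (run_max y).+1)%N%:R - (run_max x < run_max y)%N%:R)) <= _).
  apply: le_coin_exp => // x _; rewrite ltnS.
  by case: ltngtP => /=; lra.
rewrite coin_expD coin_expB coin_exp_cst !run_max_survival_half lerD2l.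
by have := survival_incr R i (run_max y); lra.
Qed.

(** [survival_shift] restores the [L] letters set aside, so that only maxima of the full sides
    appear; the starting level rises by [L + 2]. *)
Lemma overtakes_half L i n :
  1 - max_le_mass (n + L) i - (L + 2)%:R * survival R (n + L) 1 - 2^-1 ^+ L
    <= success (2^-1 : R) (overtakes L) i (n + L).
Proof.
have h : 1 - 2^-1 = 2^-1 :> R by lra.
have := @overtakes_ge 2^-1 L i n; rewrite h => /(_ ltac:(lra)).
apply: le_trans; rewrite lerD2r -addrA lerD2l -opprD lerN2.
rewrite (coin_exp_depth _ _ (fun d => survival R n (d + 3))) h.
rewrite -[X in _ <= _ + X](coin_exp_cst 2^-1 i) -coin_expD.
apply: le_coin_exp => [|x _]; first by lra.
apply: le_trans (survival_shift R n (run_max x + 3) L) _.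
rewrite (_ : run_max x + 3 + L = (run_max x).+1 + (L + 2))%N; last by lia.
exact: survival_addr.
Qed.

Lemma is_overtaken_half L i n :
  1 - max_le_mass (L + i) n - L%:R * survival R (L + i) 1 - 2^-1 ^+ L - 2^-1 ^+ n
    <= success (2^-1 : R) (is_overtaken L) (L + i) n.
Proof.
have h : 1 - 2^-1 = 2^-1 :> R by lra.
have := @is_overtaken_ge 2^-1 L i n; rewrite h => /(_ ltac:(lra)).
apply: le_trans; rewrite !lerD2r -addrA lerD2l -opprD lerN2.
rewrite -[X in _ <= _ + X](coin_exp_cst 2^-1 n) -coin_expD.
apply: le_coin_exp => [|y _]; first by lra.
apply: le_trans (survival_shift R i (run_max y).+1 L) _.
by rewrite [(i + L)%N]addnC; exact: survival_addr.
Qed.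

End success_bounds.

Section success_limits.
Variable R : realType.
Implicit Types (p eps : R).

Lemma expr_small (x eps : R) : 0 <= x < 1 -> 0 < eps ->
  exists K, forall n, (K <= n)%N -> x ^+ n <= eps.
Proof.
move=> /andP[x0 x1] eps0.
have /cvgr_lt/(_ eps eps0)[K _ HK] : ((x ^+ n) @[n --> \oo] --> (0 : R)).
  by apply: cvg_expr; rewrite ger0_norm.
by exists K => n Kn; apply/ltW/HK.
Qed.

Lemma survival_small (c : nat) eps : 0 < eps ->
  exists K, forall n, (K <= n)%N -> c%:R * survival R n 1 <= eps.
Proof.
move=> eps0; have c0 : 0 < c.+1%:R :> R by [].
have [K HK] := @survival_cvg0 R (eps / c.+1%:R) (divr_gt0 eps0 c0).
exists K => n /HK; rewrite ler_pdivlMr // mulrC; apply: le_trans.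
by rewrite ler_wpM2r ?survival_ge0 // ler_nat.
Qed.

Lemma overtakes_lt_half p eps : 0 < p < 2^-1 -> 0 < eps ->
  exists L K, forall i n, (K <= i)%N -> (K <= n)%N ->
    1 - eps <= success p (overtakes L) i n.
Proof.
move=> /andP[p0 p2] eps0; have e3 : 0 < eps / 3 by lra.
have [L HL] := @expr_small (1 - p) _ ltac:(lra) e3.
have r01 : 0 <= (1 - (1 - p)) / (1 - p) < 1.
  by rewrite divr_ge0 ?ltr_pdivrMr; lra.
have [k Hk] := expr_small r01 e3.
have [K HK] := survival_small (k + 3) e3.
exists L, (K + L)%N => i n _ Kn.
have := @overtakes_ge R p L i (n - L); rewrite subnK; last by lia.
move=> /(_ ltac:(lra)); apply: le_trans.
rewrite (coin_exp_depth _ _ (fun d => survival R _ (d + 3))).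
have := @survival_tail R (1 - p) i (n - L) k ltac:(lra).
have := HL L (leqnn _); have := Hk k (leqnn _); have := HK (n - L)%N ltac:(lia).
lra.
Qed.

Lemma is_overtaken_gt_half p eps : 2^-1 < p < 1 -> 0 < eps ->
  exists L K, forall i n, (K <= i)%N -> (K <= n)%N ->
    1 - eps <= success p (is_overtaken L) i n.
Proof.
move=> /andP[p2 p1] eps0; have e4 : 0 < eps / 4 by lra.
have [L HL] := @expr_small p _ ltac:(lra) e4.
have [M HM] := @expr_small (1 - p) _ ltac:(lra) e4.
have r01 : 0 <= (1 - p) / p < 1 by rewrite divr_ge0 ?ltr_pdivrMr; lra.
have [k Hk] := expr_small r01 e4.
have [K HK] := survival_small (k + 3) e4.
exists L, (K + L + M)%N => i n Ki Kn.
have := @is_overtaken_ge R p L (i - L) n; rewrite subnKC; last by lia.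
move=> /(_ ltac:(lra)); apply: le_trans.
have := @survival_tail R p n (i - L) k ltac:(lra).
have : coin_exp p n (fun y => survival R (i - L) (run_max y).+1) <=
    coin_exp p n (fun s => survival R (i - L) (run_max s + 3)).
  apply: le_coin_exp => [|y _]; first by lra.
  by apply: survival_mono; lia.
have := HL L (leqnn _); have := Hk k (leqnn _); have := HK (i - L)%N ltac:(lia).
have := HM n ltac:(lia).
lra.
Qed.

Lemma overtakes_eq_half eps : 0 < eps ->
  exists L K, forall i n, (K <= i)%N -> (K <= n)%N -> 1 - eps <=
    success (2^-1 : R) (overtakes L) i n + success 2^-1 (overtakes L) n i.
Proof.
(* Five errors: a tie, two survival terms with factor [L + 2], and two powers [2^-1 ^+ L]. *)
move=> eps0; have e5 : 0 < eps / 5 by lra.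
have [L HL] := @expr_small 2^-1 _ ltac:(lra) e5.
have [K HK] := survival_small (L + 2) e5.
exists L, (K + L)%N => i n Ki Kn.
have := @overtakes_half R L i (n - L); rewrite subnK; last by lia.
have := @overtakes_half R L n (i - L); rewrite subnK; last by lia.
have := HK i ltac:(lia); have := HK n ltac:(lia); have := HL L (leqnn _).
have := max_le_massD R i n; have : survival R i 1 <= (L + 2)%:R * survival R i 1.
  by rewrite ler_peMl ?survival_ge0 // ler1n addn2.
lra.
Qed.

Lemma is_overtaken_eq_half eps : 0 < eps ->
  exists L K, forall i n, (K <= i)%N -> (K <= n)%N -> 1 - eps <=
    success (2^-1 : R) (is_overtaken L) i n + success 2^-1 (is_overtaken L) n i.
Proof.
(* Besides the five errors of the other event, there is the chance of no 2 after the 1, once for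
   each order of the sides. *)
move=> eps0; have e7 : 0 < eps / 7 by lra.
have [L HL] := @expr_small 2^-1 _ ltac:(lra) e7.
have [K HK] := survival_small (L + 2) e7.
exists L, (K + L)%N => i n Ki Kn.
have := @is_overtaken_half R L (i - L) n; rewrite subnKC; last by lia.
have := @is_overtaken_half R L (n - L) i; rewrite subnKC; last by lia.
have := HK i ltac:(lia); have := HK n ltac:(lia); have := HL L (leqnn _).
have := HL i ltac:(lia); have := HL n ltac:(lia).
have := survival_ge0 R i 1; have := survival_ge0 R n 1.
have := max_le_massD R i n; rewrite natrD !mulrDl.
lra.
Qed.

End success_limits.

(** * The law of the initial condition *)

Section coin_words.
Variables (R : realType) (p : R).
Hypotheses (p0 : 0 < p) (p1 : p < 1).

Definition letter_mass (b : bool) : R := if b then p else 1 - p.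

Lemma big_tupleS n (F : n.+1.-tuple bool -> R) :
  \sum_e F e = \sum_(e : n.-tuple bool) F [tuple of true :: e]
               + \sum_(e : n.-tuple bool) F [tuple of false :: e].
Proof.
rewrite (reindex (fun be : bool * n.-tuple bool => [tuple of be.1 :: be.2])) /=.
  rewrite -(pair_bigA _ (fun b (e : n.-tuple bool) => F [tuple of b :: e])) /=.
  by rewrite big_bool.
exists (fun e : n.+1.-tuple bool => (thead e, [tuple of behead e])).
  by move=> [b e] _ /=; rewrite theadE; congr pair; exact: val_inj.
by move=> e _; rewrite [RHS]tuple_eta.
Qed.

Lemma sum_words n (f : seq bool -> R) :
  \sum_(e : n.-tuple bool) (\prod_(b <- e) letter_mass b) * f e =
  coin_exp p n f.
Proof.
elim: n f => [|n IH] f /=.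
  rewrite (bigD1 [tuple]) //= big_nil mul1r big1 ?addr0 // => e.
  by rewrite tuple0 => /eqP.
rewrite big_tupleS -!IH !mulr_sumr; congr (_ + _);
  by apply: eq_bigr => e _; rewrite big_cons /= mulrA.
Qed.

Lemma bernoulli_wordE n (e : n.+1.-tuple bool) :
  bernoulli_word p e = \prod_(b <- e) letter_mass b.
Proof.
rewrite big_tuple; apply: eq_bigr => i _.
rewrite bernoulli_probE ?ltW // !diracE /letter_mass.
have M (a b : bool) : (a \in [set b]) = (a == b).
  by apply/idP/eqP; rewrite in_setE.
by rewrite !M; case: (tnth e i); rewrite /= ?mulr1 ?mulr0 ?addr0 ?add0r.
Qed.

Lemma bernoulli_word_ge0 n (e : n.+1.-tuple bool) : 0 <= bernoulli_word p e.
Proof.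
rewrite bernoulli_wordE; apply: prodr_ge0 => b _.
by rewrite /letter_mass; case: b; rewrite ?subr_ge0 ltW.
Qed.

Definition mass n (phi : pred (n.+1.-tuple 'I_3)) : R :=
  \sum_(w | phi w) initial_pmf p w.

Lemma initial_lawE n (A : set (Omega n.+1)) :
  initial_law p n A = (mass (fun w => w \in A))%:E.
Proof.
rewrite /initial_law fsbig_finite//= sumEFin; congr EFin.
rewrite /mass -[RHS]big_filter; apply: perm_big.
rewrite uniq_perm ?finmap.fset_uniq ?filter_uniq ?index_enum_uniq // => w.
by rewrite mem_filter mem_index_enum andbT in_fset_set //; exact: finite_finset.
Qed.

Lemma massE n (phi : pred (n.+1.-tuple 'I_3)) :
  mass phi = \sum_e bernoulli_word p e *
    \sum_u position_pmf R e u * (phi (put_second e u))%:R.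
Proof.
rewrite /mass /initial_pmf.
transitivity (\sum_(eu : n.+1.-tuple bool * 'I_n.+1 | phi (put_second eu.1 eu.2))
    bernoulli_word p eu.1 * position_pmf R eu.1 eu.2).
  rewrite [RHS](partition_big (fun eu => put_second eu.1 eu.2) phi) //=.
  apply: eq_bigr => w phiw; apply: eq_bigl => eu.
  by case: eqP => [->|_]; rewrite ?phiw ?andbF.
rewrite big_mkcond /= -(pair_bigA _ (fun e u => if phi (put_second e u) then
  bernoulli_word p e * position_pmf R e u else 0)) /=.
apply: eq_bigr => e _; rewrite mulr_sumr; apply: eq_bigr => u _.
by case: (phi _); rewrite ?mulr1 ?mulr0.
Qed.

(** Replacing the number of 0s by its mean in the denominator costs at most their relative
    difference, since at most all the 0s are counted in the numerator. *)
Lemma position_pmf_ge n (e : n.+1.-tuple bool) (g : 'I_n.+1 -> bool) :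
  ((1 - p) * n.+1%:R)^-1 * (\sum_u (~~ tnth e u && g u)%:R
    - `|(zeros_count e)%:R - (1 - p) * n.+1%:R|)
  <= \sum_u position_pmf R e u * (g u)%:R.
Proof.
set q := (1 - p) * n.+1%:R.
have q0 : 0 < q by rewrite mulr_gt0 // subr_gt0.
set k := zeros_count e; set S : R := \sum_u (~~ tnth e u && g u)%:R.
have kE : #|zeros e| = k.
  rewrite /k /zeros_count -(sum1_count (val e) negb) big_tuple -sum1_card.
  by apply: eq_bigl => u; rewrite inE.
have S0 : 0 <= S by apply: sumr_ge0.
have Sk : S <= k%:R.
  rewrite -kE -sum1_card natr_sum big_mkcond /=; apply: ler_sum => u _.
  by rewrite inE; case: (tnth e u); case: (g u).
have [z0|z0] := eqVneq (zeros e) finset.set0.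
  have {}k0 : k = 0%N by rewrite -kE z0 cards0.
  have S00 : S = 0 by apply/le_anti; rewrite S0 andbT (le_trans Sk) // k0.
  rewrite S00 sub0r; apply: le_trans (_ : 0 <= _).
    by rewrite pmulr_rle0 ?invr_gt0 // oppr_le0.
  apply: sumr_ge0 => u _; apply: mulr_ge0 => //.
  by rewrite /position_pmf; case: ifP => // _; rewrite divr_ge0.
have kgt : 0 < k%:R :> R by rewrite ltr0n -kE card_gt0 z0.
have -> : \sum_u position_pmf R e u * (g u)%:R = S / k%:R.
  rewrite /S mulr_suml; apply: eq_bigr => u _.
  rewrite /position_pmf (negbTE z0) kE inE.
  by case: (tnth e u); case: (g u); rewrite /= ?mul0r ?mulr0 ?mul1r ?mulr1.
have [Dl Du] : - `|k%:R - q| <= k%:R - q /\ k%:R - q <= `|k%:R - q|.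
  by split; [rewrite lerNl -normrN ler_norm|exact: ler_norm].
rewrite mulrC ler_pdivrMr // mulrAC ler_pdivlMr //.
set D := `|_| in Dl Du *.
have D0 : 0 <= D by exact: normr_ge0.
nra.
Qed.

End coin_words.

Section put_second_facts.
Variable n : nat.
Implicit Types (e : n.+1.-tuple bool) (u : 'I_n.+1).

Lemma letter_put_second e u i : (i < n.+1)%N -> letter (put_second e u) i =
  if i == u then 1 else if nth false e i then 2 else 0.
Proof.
move=> ni; transitivity (tnth (put_second e u) (Ordinal ni)).
  by rewrite (tnth_nth ord0).
by rewrite tnth_mktuple (tnth_nth false).
Qed.

Lemma single1_put_second e u : single1 (put_second e u) u.
Proof.
split=> // i; have [ni|ni] := ltnP i n.+1.
  by rewrite letter_put_second //; have [//|_] := eqVneq i u; case: (nth false e i).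
rewrite letter_over //; apply/esym/negbTE; apply: contraTneq ni => ->.
by rewrite -ltnNge.
Qed.

Lemma two_put_second e u : ~~ nth false e u ->
  two (put_second e u) = nth false e.
Proof.
move=> eu; apply/funext => i; have [ni|ni] := ltnP i n.+1.
  rewrite /two letter_put_second //.
  have [->|_] := eqVneq i u; first by rewrite (negbTE eu).
  by case: (nth false e i).
by rewrite two_over // nth_default // size_tuple.
Qed.

Lemma split_word e u : ~~ nth false e u ->
  val e = take u e ++ false :: drop u.+1 e.
Proof.
move=> eu; rewrite -(negbTE eu) -drop_nth ?cat_take_drop //.
by rewrite size_tuple.
Qed.

Lemma overtakes_excess L e u : ~~ nth false e u ->
  overtakes L (take u e) (drop u.+1 e) -> excess (put_second e u) = 0.
Proof.
move=> eu /andP[]; have E := split_word eu.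
have sx : size (take u e) = u by rewrite size_takel // size_tuple ltnW.
move: (drop u.+1 e) E => y E nd t2.
apply: (excess0_seq _ _ nd t2); first by rewrite sx; exact: single1_put_second.
by rewrite cat_take_drop two_put_second // -E.
Qed.

Lemma is_overtaken_excess L e u : ~~ nth false e u ->
  is_overtaken L (take u e) (drop u.+1 e) -> excess (put_second e u) = 1.
Proof.
move=> eu /and3P[]; have E := split_word eu.
have sx : size (take u e) = u by rewrite size_takel // size_tuple ltnW.
move: (take u e) sx E => x sx E f1 t2 lt.
apply: (excess1_seq _ _ f1 t2 lt); rewrite cat_take_drop.
  by rewrite sx; exact: single1_put_second.
by rewrite two_put_second // -E.
Qed.

End put_second_facts.

(** * From conditional success probabilities to the initial law *)

Section mass_bounds.
Variables (R : realType) (p : R).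
Hypotheses (p0 : 0 < p) (p1 : p < 1).
Let p01 : 0 <= p <= 1. Proof. by rewrite !ltW. Qed.

(** The letter at [u] is a 0 with probability [1 - p], independently of both sides. After
    normalizing by the mean number of 0s this factor cancels, and the variance bounds the error. *)
Lemma mass_ge n (phi : pred (n.+1.-tuple 'I_3)) (good : seq bool -> seq bool -> bool)
    (delta : R) : 0 < delta ->
  (forall (e : n.+1.-tuple bool) (u : 'I_n.+1), ~~ nth false e u ->
     good (take u e) (drop u.+1 e) -> phi (put_second e u)) ->
  n.+1%:R^-1 * (\sum_(u < n.+1) success p good u (n - u)%N)
    - delta - p / (delta * (1 - p)) / n.+1%:R <= mass p phi.
Proof.
move=> d0 gphi; set M : R := n.+1%:R; have M0 : 0 < M by rewrite ltr0n.
have q0 : 0 < 1 - p by rewrite subr_gt0.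
have qM0 : 0 < (1 - p) * M by rewrite mulr_gt0.
pose hit (u : 'I_n.+1) (e : n.+1.-tuple bool) := ~~ tnth e u && phi (put_second e u).
pose D (s : seq bool) : R := (zeros_count s)%:R - (1 - p) * M.
have hitE (u : 'I_n.+1) : (1 - p) * success p good u (n - u)%N <=
    \sum_(e : n.+1.-tuple bool) bernoulli_word p e * (hit u e)%:R.
  pose f (s : seq bool) : R :=
    (~~ nth false s u && good (take u s) (drop u.+1 s))%:R.
  apply: le_trans (_ : coin_exp p n.+1 f <= _); last first.
    rewrite -sum_words; apply: ler_sum => e _; rewrite -bernoulli_wordE //.
    apply: ler_wpM2l; first exact: bernoulli_word_ge0.
    rewrite /f /hit (tnth_nth false) ler_nat.
    by case: (boolP (nth false e u)) => //= eu; case: (boolP (good _ _)) => //= g;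
      rewrite gphi.
  have nE : n.+1 = (u + (n - u).+1)%N by have := ltn_ord u; lia.
  rewrite [X in coin_exp p X f]nE coin_exp_cat /success -coin_expZ.
  apply: le_coin_exp => // x sx /=; rewrite ler_wpDl //.
    apply: mulr_ge0; rewrite ?(ltW p0) //.
    by apply: coin_exp_ge0 => // s; rewrite /f.
  apply: ler_wpM2l; first exact: ltW.
  apply: le_coin_exp => // y sy; rewrite /f nth_cat sx ltnn subnn /=.
  by rewrite -sx take_size_cat // -cat_rcons drop_size_cat ?size_rcons.
have DE : \sum_(e : n.+1.-tuple bool) bernoulli_word p e * `|D (val e)| <=
    delta * ((1 - p) * M) + p / delta.
  have -> : \sum_(e : n.+1.-tuple bool) bernoulli_word p e * `|D (val e)| =
      coin_exp p n.+1 (fun s => `|D s|).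
    by rewrite -sum_words; apply: eq_bigr => e _; rewrite -bernoulli_wordE.
  (* From [|D| <= t + D^2 / t]; with this [t] the variance term is exactly [p / delta]. *)
  set t := delta * _; have t0 : 0 < t by rewrite mulr_gt0.
  apply: le_trans (_ : coin_exp p n.+1 (fun s => t + t^-1 * (D s) ^+ 2) <= _).
    apply: le_coin_exp => // s _.
    rewrite -(ler_pM2l t0) mulrDr mulVKf ?lt0r_neq0 //.
    rewrite -[D s ^+ 2]real_normK ?num_real //.
    by have := normr_ge0 (D s); nra.
  rewrite coin_expD coin_exp_cst coin_expZ coin_exp_variance lerD2l -/M.
  rewrite /t le_eqVlt; apply/orP; left; apply/eqP.
  by field; rewrite !lt0r_neq0.
rewrite massE; apply: le_trans (_ : \sum_(e : n.+1.-tuple bool) bernoulli_word p e *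
  (((1 - p) * M)^-1 * (\sum_u (hit u e)%:R - `|D (val e)|)) <= _); last first.
  apply: ler_sum => e _; apply: ler_wpM2l; first exact: bernoulli_word_ge0.
  exact: (position_pmf_ge p1 e (fun u => phi (put_second e u))).
have -> : \sum_(e : n.+1.-tuple bool) bernoulli_word p e *
    (((1 - p) * M)^-1 * (\sum_u (hit u e)%:R - `|D (val e)|)) =
  ((1 - p) * M)^-1 * (
    \sum_u \sum_(e : n.+1.-tuple bool) bernoulli_word p e * (hit u e)%:R
    - \sum_(e : n.+1.-tuple bool) bernoulli_word p e * `|D (val e)|).
  rewrite exchange_big /= -sumrB mulr_sumr; apply: eq_bigr => e _.
  by rewrite -mulr_sumr -mulrBr mulrCA.
rewrite -(ler_pM2l qM0) mulrA divff ?lt0r_neq0 // mul1r.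
apply: le_trans (_ : \sum_(u < n.+1) (1 - p) * success p good u (n - u)%N -
    (delta * ((1 - p) * M) + p / delta) <= _); last first.
  by apply: lerB => //; apply: ler_sum => u _; exact: hitE.
rewrite -mulr_sumr; set S := \sum_(_ < _) _.
rewrite le_eqVlt; apply/orP; left; apply/eqP.
by field; rewrite !lt0r_neq0.
Qed.

Lemma mass_ge0 n (phi : pred (n.+1.-tuple 'I_3)) : 0 <= mass p phi.
Proof. by apply: sumr_ge0 => w _; exact: initial_pmf_ge0. Qed.

Lemma success_ge0 good i n : 0 <= success p good i n.
Proof. by do 2!(apply: coin_exp_ge0 => // ?). Qed.

Lemma sum_small n K : \sum_(u < n) (u < K)%:R <= K%:R :> R.
Proof.
rewrite -natr_sum ler_nat; have -> : (\sum_(u < n) (u < K) = minn n K)%N.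
  by elim: n => [|n IH]; rewrite ?big_ord0 ?min0n // big_ord_recr /= IH; lia.
exact: geq_minr.
Qed.

(** Pairing [u] with [n - u] makes a bound on the symmetrized sum enough; places within [K] of an
    end are given up. *)
Lemma average_ge (S : nat -> nat -> R) (l : R) K n :
  (forall i j, 0 <= S i j) -> l <= 2 ->
  (forall i j, (K <= i)%N -> (K <= j)%N -> l <= S i j + S j i) ->
  l / 2 * n.+1%:R - 2 * K%:R <= \sum_(u < n.+1) S u (n - u)%N.
Proof.
move=> S0 l2 Sl; set T := \sum_(_ < _) _.
have TE : T = \sum_(u < n.+1) S (n - u)%N u.
  rewrite /T (reindex_inj rev_ord_inj) /=; apply: eq_bigr => u _.
  by rewrite subSS subKn // -ltnS.
have K1 := sum_small n.+1 K.
have K2 : \sum_(u < n.+1) (n - u < K)%N%:R <= K%:R :> R.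
  rewrite (reindex_inj rev_ord_inj) /=; apply: le_trans K1.
  by apply: ler_sum => u _; rewrite subSS subKn // -ltnS.
have : \sum_(u < n.+1) (l - 2 * (u < K)%:R - 2 * (n - u < K)%N%:R) <= T + T.
  rewrite {2}TE /T -big_split /=; apply: ler_sum => u _.
  have := S0 u (n - u)%N; have := S0 (n - u)%N u.
  case: (ltnP u K) => uK; case: (ltnP (n - u) K) => nK /=; try lra.
  by have := Sl _ _ uK nK; lra.
rewrite !big_split /= !sumrN -!mulr_sumr sumr_const card_ord -mulr_natr; lra.
Qed.

Lemma mass_lim_inf (good : nat -> seq bool -> seq bool -> bool)
    (phi : forall n, pred (n.+1.-tuple 'I_3)) (l : R) : l <= 1 ->
  (forall L n (e : n.+1.-tuple bool) (u : 'I_n.+1), ~~ nth false e u ->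
     good L (take u e) (drop u.+1 e) -> phi n (put_second e u)) ->
  (forall eps, 0 < eps -> exists L K, forall i j, (K <= i)%N -> (K <= j)%N ->
     2 * l - eps <= success p (good L) i j + success p (good L) j i) ->
  forall eps, 0 < eps -> exists N, forall n, (N <= n)%N ->
    l - eps <= mass p (phi n).
Proof.
move=> l1 gphi Hl eps eps0; have [L [K HK]] := Hl eps eps0.
have q0 : 0 < 1 - p by rewrite subr_gt0.
pose delta := eps / 4; have d0 : 0 < delta by rewrite divr_gt0.
(* For [n.+1] beyond [B] the boundary and variance terms together cost at most [eps / 4]; [delta]
   costs as much, and the average costs [eps / 2]. *)
pose B := (2 * K%:R + p / (delta * (1 - p))) * (4 / eps).
have B0 : 0 <= B.
  rewrite mulr_ge0 ?addr_ge0 ?divr_ge0 ?mulr_ge0 //; exact: ltW.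
exists (Num.bound B) => n Nn; have M0 : 0 < n.+1%:R :> R by rewrite ltr0n.
have BM : B <= n.+1%:R.
  by apply/ltW/(lt_le_trans (archi_boundP B0)); rewrite ler_nat ltnW.
apply: le_trans (mass_ge d0 (gphi L n)).
have := @average_ge (success p (good L)) (2 * l - eps) K n
  (success_ge0 _) ltac:(lra) HK.
set T := \sum_(_ < _) _ => hT.
have {}BM : 2 * K%:R + p / (delta * (1 - p)) <= n.+1%:R * delta.
  by move: BM; rewrite /B /delta -ler_pdivlMr ?divr_gt0 // invf_div mulrA.
move: BM; set P := p / _ => BM.
have PM : n.+1%:R * (P / n.+1%:R) = P by rewrite mulrC divfK // lt0r_neq0.
rewrite -(ler_pM2l M0) !mulrBr mulVKf ?lt0r_neq0 // PM.
by move: hT BM; rewrite /delta; nra.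
Qed.

End mass_bounds.

Section excess_mass.
Variables (R : realType) (p : R).
Hypotheses (p0 : 0 < p) (p1 : p < 1).

Definition limit_mass0 : R := if 2^-1 < p then 0 else if p == 2^-1 then 2^-1 else 1.

(** Lower bounds for the masses at 0 and at 1 suffice: their limits add up to 1, so no mass is left
    elsewhere. *)
Lemma excess0_mass : forall eps : R, 0 < eps -> exists N, forall n, (N <= n)%N ->
  limit_mass0 - eps <= mass p (fun w : n.+1.-tuple 'I_3 => excess w == 0).
Proof.
rewrite /limit_mass0; case: ifP => [_|/negbT].
  move=> eps eps0; exists 0%N => n _.
  by rewrite sub0r (le_trans _ (mass_ge0 _ _)) // oppr_le0 ltW.
rewrite -leNgt => p2.
apply: (mass_lim_inf p0 p1 (good := overtakes)).
- by case: ifP => _; lra.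
- by move=> L n e u eu ov; apply/eqP; exact: overtakes_excess ov.
move=> eps eps0; case: eqVneq => [->|np].
  have [L [K H]] := overtakes_eq_half eps0; exists L, K => i j Ki Kj.
  by have := H i j Ki Kj; lra.
have pl : 0 < p < 2^-1 by rewrite p0 lt_neqAle np.
have [L [K H]] := overtakes_lt_half pl (ltac:(lra) : 0 < eps / 2).
exists L, K => i j Ki Kj.
by have := H i j Ki Kj; have := H j i Kj Ki; lra.
Qed.

Lemma excess1_mass : forall eps : R, 0 < eps -> exists N, forall n, (N <= n)%N ->
  1 - limit_mass0 - eps <= mass p (fun w : n.+1.-tuple 'I_3 => excess w == 1).
Proof.
have [p2|p2] := ltP p 2^-1.
  move=> eps eps0; exists 0%N => n _; rewrite /limit_mass0 ltNge (ltW p2) /= lt_eqF //.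
  by rewrite subrr sub0r (le_trans _ (mass_ge0 _ _)) // oppr_le0 ltW.
apply: (mass_lim_inf p0 p1 (good := is_overtaken)).
- by rewrite /limit_mass0; case: ifP => _; [|case: ifP => _]; lra.
- by move=> L n e u eu ov; apply/eqP; exact: is_overtaken_excess ov.
move=> eps eps0; rewrite /limit_mass0; case: ifP => [pl|_].
  have pl' : 2^-1 < p < 1 by rewrite pl.
  have [L [K H]] := is_overtaken_gt_half pl' (ltac:(lra) : 0 < eps / 2).
  exists L, K => i j Ki Kj.
  by have := H i j Ki Kj; have := H j i Kj Ki; lra.
case: eqVneq => [->|np].
  have [L [K H]] := is_overtaken_eq_half eps0; exists L, K => i j Ki Kj.
  by have := H i j Ki Kj; lra.
exists 0%N, 0%N => i j _ _.
by have := success_ge0 p0 p1 (is_overtaken 0) i j;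
  have := success_ge0 p0 p1 (is_overtaken 0) j i; lra.
Qed.

End excess_mass.

(** * Convergence in distribution *)

Section cdf_bounds.
Context d (T : measurableType d) (R : realType) (P : probability T R).
Variables (Y : {RV P >-> R}) (y0 y1 : R).
Hypotheses (Y0 : P (Y @^-1` [set 0]) = y0%:E)
  (Y1 : P (Y @^-1` [set 1]) = y1%:E).

(** Sandwich by the atoms at 0 and 1, wherever the remaining mass lies; the bounds meet when the
    atoms carry everything. *)
Lemma cdf_bounds x : exists c : R, [/\ cdf Y x = c%:E,
  y0 + y1 <= 1,
  (if x < 0 then 0 else if x < 1 then y0 else y0 + y1) <= c
  & c <= (if x < 0 then 1 - y0 - y1 else if x < 1 then 1 - y1 else 1)].
Proof.
pose y (t : T) : R := Y t.
have mY (A : set R) : measurable A -> measurable (y @^-1` A).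
  by move=> mA; rewrite -[_ @^-1` _]setTI; exact: measurable_funP.
pose B := (y @^-1` `]-oo, x]).
have mB : measurable B by apply: mY; exact: measurable_itv.
have m0 : measurable (y @^-1` [set 0]) by apply: mY.
have m1 : measurable (y @^-1` [set 1]) by apply: mY.
have cE : cdf Y x = (fine (P B))%:E by rewrite fineK ?fin_num_measure.
set c := fine _ in cE; exists c.
have PB : P B = c%:E by rewrite /c fineK ?fin_num_measure.
have d01 : ((y @^-1` [set 0]) `&` (y @^-1` [set 1]) = set0).
  apply/seteqP; split=> // t [/= ->] /eqP; by rewrite eq_sym oner_eq0.
have P01 : P ((y @^-1` [set 0]) `|` (y @^-1` [set 1])) = (y0 + y1)%:E.
  by rewrite measureU // EFinD; congr (_ + _)%E; [exact: Y0 | exact: Y1].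
have m01 : measurable ((y @^-1` [set 0]) `|` (y @^-1` [set 1])).
  exact: measurableU.
have le01 : y0 + y1 <= 1 by rewrite -lee_fin -P01 probability_le1.
have disj (A : set T) a : measurable A -> P A = a%:E -> (A `&` B = set0) ->
    c <= 1 - a.
  move=> mA PA AB; rewrite lerBrDl -lee_fin EFinD -PA -PB -measureU //.
  by apply: probability_le1; exact: measurableU.
have sub (A : set T) a : measurable A -> P A = a%:E -> (A `<=` B) -> a <= c.
  by move=> mA PA AB; rewrite -lee_fin -PA -PB le_measure ?inE.
have BE t : B t = (y t <= x) by rewrite /B /= in_itv.
split=> //.
  case: ltP => x0; first by rewrite -lee_fin -PB.
  case: ltP => x1.
    by apply: (sub _ _ m0 Y0) => t /= yt; rewrite BE yt.
  by apply: (sub _ _ m01 P01) => t /= [] yt; rewrite BE yt.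
case: ltP => x0.
  rewrite -addrA -opprD; apply: (disj _ _ m01 P01).
  apply/seteqP; split=> // t [] /= [] yt; rewrite BE yt leNgt.
    by rewrite x0.
  by rewrite (lt_trans x0).
case: ltP => x1; last by rewrite -lee_fin -PB probability_le1.
apply: (disj _ _ m1 Y1); apply/seteqP; split=> // t [] /= yt.
by rewrite BE yt leNgt x1.
Qed.

End cdf_bounds.

Section excess_law.
Variables (R : realType) (p : R) (n : nat).

Lemma excess_RV_preimage (k : int) :
  initial_law p n (@excess_RV R n.+1 @^-1` [set k%:~R]) =
  (mass p (fun w : n.+1.-tuple 'I_3 => excess w == k))%:E.
Proof.
rewrite initial_lawE; congr EFin; apply: eq_bigl => w.
apply/idP/eqP; rewrite in_setE /= /excess_RV.
  by move/eqP; rewrite eqr_int => /eqP.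
by move=> ->.
Qed.

End excess_law.

Lemma excess_cvg (R : realType) (p : R) (p0 : 0 < p) (p1 : p < 1)
    d (S : measurableType d) (P : probability S R) (Y : {RV P >-> R}) :
  P (Y @^-1` [set 0]) = (limit_mass0 p)%:E ->
  P (Y @^-1` [set 1]) = (1 - limit_mass0 p)%:E ->
  cvg_in_distribution
    (fun n => @excess_RV R n.+1 : {RV (initial_law p n) >-> R}) Y.
Proof.
move=> Y0 Y1 x _; set l := limit_mass0 p in Y0 Y1.
have [c [-> _ cl cu]] := cdf_bounds Y0 Y1 x.
pose X n : {RV (initial_law p n) >-> R} := @excess_RV R n.+1.
have X0 n : initial_law p n (X n @^-1` [set 0]) = _ := excess_RV_preimage p n 0.
have X1 n : initial_law p n (X n @^-1` [set 1]) = _ := excess_RV_preimage p n 1.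
apply: cvg_EFin.
  by apply: nearW => n; have [c' [-> _ _ _]] := cdf_bounds (X0 n) (X1 n) x.
apply/cvgrPdist_le => /= eps eps0.
(* For negative [x] the upper bound involves the deficits of both atoms, each at most [eps / 2]. *)
have e2 : 0 < eps / 2 by lra.
have [N0 H0] := excess0_mass p0 p1 e2; have [N1 H1] := excess1_mass p0 p1 e2.
exists (maxn N0 N1) => // n /=; rewrite geq_max => /andP[n0 n1].
have := H0 n n0; have := H1 n n1.
have [c' [cE c1 cl' cu']] := cdf_bounds (X0 n) (X1 n) x.
rewrite -[X in `|_ - X|]/(fine (cdf (X n) x)) cE /= ler_norml -/l.
move: c1 cl' cu' cl cu.
case: ifP => _; [|case: ifP => _]; set a := mass p _; set b := mass p _;
  move=> *; apply/andP; split; lra.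
Qed.

Theorem theorem1p2 (R : realType) (p : R) (p0 : 0 < p) (p1 : p < 1)
    (d : measure_display) (S : measurableType d) (P : probability S R)
    (X : {RV P >-> R})
    (X0 : P (X @^-1` [set 0]) = (2^-1)%:E)
    (X1 : P (X @^-1` [set 1]) = (2^-1)%:E) :
  cvg_in_distribution
    (fun n => @excess_RV R n.+1 : {RV (initial_law p n) >-> R})
    (if 2^-1 < p then cst 1 : {RV P >-> R}
     else if p == 2^-1 then X
     else cst 0 : {RV P >-> R}).
Proof.
have cst1 (a b : R) : P ((cst a : {RV P >-> R}) @^-1` [set b]) =
    (a == b)%:R%:E.
  rewrite preimage_cst; case: eqVneq => [->|ab].
    by rewrite mem_set // probability_setT.
  by rewrite memNset ?measure0 // => /= E; rewrite E eqxx in ab.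
have h01 : (0 == 1 :> R) = false by rewrite eq_sym oner_eq0.
have half : 1 - 2^-1 = 2^-1 :> R by lra.
case: ifP => [p2|p2]; last case: ifP => [pe|pe]; apply: excess_cvg => //;
  rewrite /limit_mass0 p2 ?pe.
- by rewrite cst1 oner_eq0.
- by rewrite cst1 eqxx subr0.
- exact: X0.
- by rewrite half; exact: X1.
- by rewrite cst1 eqxx.
- by rewrite cst1 h01 subrr.
Qed.
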